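(* Let $p\in[2,\infty)$ and let $\mu$ be a Borel probability measure on a compact set $\Omega$. There is a number $C=C(p)$, depending only on $p$, such that, if $L$ is an $N$-dimensional subspace of $L^p(\mu)\cap C(\Omega)$ such that $$\|f\|_\infty\le MN^{1/p}\|f\|_p\quad\forall f\in L,$$ then for every integer $m\ge2$ $$\mathbb{E}\sup_{f\in B_p(L)}\Bigl|\frac1m\sum_{j=1}^m|f(X_j)|^p-\|f\|_p^p\Bigr|\le C\Bigl(\frac{[\log m]^p}{m}M^pN+\Bigl[\frac{[\log m]^p}{m}M^pN\Bigr]^{1/p}\Bigr),$$ where $B_p(L):=\{f\in L:\|f\|_p\le1\}$ and $X_1,\dots,X_m$ are independent random points of $\Omega$ distributed according to $\mu$. In particular, for every $\varepsilon\in(0,1)$ and every $\delta\in(0,1)$ there is a big enough constant $c=c(p,\varepsilon,\delta)$ such that for every integer $m\ge cM^pN[\log(4M^pN)]^p$ one has $$(1-\varepsilon)\|f\|_p^p\le\frac1m\sum_{j=1}^m|f(X_j)|^p\le(1+\varepsilon)\|f\|_p^p\quad\forall f\in L$$ with probability greater than $1-\delta$, for any such subspace $L$.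
   Context: $\|f\|_p:=\bigl(\int_\Omega|f|^p\,d\mu\bigr)^{1/p}$ and $\|f\|_\infty:=\sup_{x\in\Omega}|f(x)|$. *)

(* Defs.v *)
From HB Require Import structures.
From mathcomp Require Import all_boot all_order all_algebra.
From mathcomp Require Import all_classical all_reals all_analysis.

Set Implicit Arguments.
Unset Strict Implicit.
Unset Printing Implicit Defensive.

Import Order.TTheory GRing.Theory Num.Theory.
Import numFieldNormedType.Exports.

Local Open Scope classical_set_scope.
Local Open Scope ring_scope.

Notation borel T := (g_sigma_algebraType (@open T)).

(* Real-valued versions of the norms: [sup] (resp. [fine]) only has its
   intended value on bounded functions (resp. when the norm is finite), which
   is the case of continuous functions on a compact space. [supnorm] is a true
   supremum, not an essential one. *)
Definition supnorm (R : realType) (T : Type) (f : T -> R) : R :=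
  sup [set `|f x| | x in [set: T]].

Definition pnorm d (T : measurableType d) (R : realType)
    (mu : {measure set T -> \bar R}) (p : R) (f : T -> R) : R :=
  fine ('N[mu]_(p%:E)[EFin \o f])%E.

(* [vectType] is restricted to finite-dimensional ambient spaces, so
   finite-dimensional subspaces of function spaces are given by a basis. *)
Definition subspace_of_dim (R : realType) (V : lmodType R) (N : nat)
    (L : set V) : Prop :=
  exists e : 'I_N -> V,
    (forall a : 'I_N -> R, \sum_(i < N) a i *: e i = 0 -> forall i, a i = 0) /\
    L = [set \sum_(i < N) a i *: e i | a in [set: 'I_N -> R]].

Definition unit_pball d (T : measurableType d) (R : realType)
    (mu : {measure set T -> \bar R}) (p : R) (L : set (T -> R)) :
    set (T -> R) :=
  [set f | L f /\ pnorm mu p f <= 1].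

Definition mutually_independent d d' (S : measurableType d)
    (T : measurableType d') (R : realType) (P : probability S R) (m : nat)
    (X : 'I_m -> {RV P >-> T}) : Prop :=
  forall (J : {set 'I_m}) (A : 'I_m -> set T),
    (forall j, j \in J -> measurable (A j)) ->
    P (\bigcap_(j in [set` J]) (X j @^-1` A j)) =
      (\prod_(j in J) P (X j @^-1` A j))%E.

Definition iid_sample d d' (S : measurableType d) (T : measurableType d')
    (R : realType) (P : probability S R) (mu : probability T R) (m : nat)
    (X : 'I_m -> {RV P >-> T}) : Prop :=
  mutually_independent X /\
  (forall j (A : set T), measurable A -> distribution P (X j) A = mu A).

Definition sample_mean (R : realType) (T : Type) (m : nat) (p : R)
    (x : 'I_m -> T) (f : T -> R) : R :=
  m%:R^-1 * \sum_(j < m) `|f (x j)| `^ p.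

(* Main.v *)
Require Import Defs.
From HB Require Import structures.
From mathcomp Require Import all_boot all_order all_algebra.
From mathcomp Require Import all_classical all_reals all_analysis.
From mathcomp Require Import measurable_realfun.
From mathcomp Require Import ring lra.

(* Put [D = M^p N], so that [|f|^p <= D ||f||_p^p] on [L]. After quantizing
   [Omega] into finitely many cells and symmetrizing, it remains to bound
   [|sum_j s_j |f(x_j)|^p|] uniformly over the unit ball of [L], for fixed points
   [x_j] and random signs [s_j].

   A function [f] is coded by comparing it with the element of smallest norm
   compatible with the answers given so far: as long as the two differ by more
   than [u_n = D^(1/p) / 2^n] at some [x_j], the code records [j] and the sign of the
   difference. By Clarkson's inequality each answer raises the [p]-th power of the
   smallest norm by at least [(u_n / 2)^p / D], so that the numbers [k_n] of answers
   at the scales [u_n] satisfy [sum_n k_n u_n^p <= 2^p D], simultaneously over all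
   scales.

   Up to a relative error [O(1/E)], [|f|^p] is a sum of links that only involve the
   scales [u_n] with [|f| / E <= u_n <= |f|]; the link at scale [u_n] has variance
   [O(E^(p-2) u_n^p sum_j |f(x_j)|^p)]. A union bound over codes in exponential
   form, with parameter proportional to [u_n^-p] at scale [u_n], gives for the
   expected deviation [Z] the inequality
   [Z <= C ((1 + Z) / E + E^(p-1) D (log m)^2 / m)], and the choice
   [E = max(E0, (D (log m)^2 / m)^(-1/p))] concludes. *)

Set Implicit Arguments.
Unset Strict Implicit.
Unset Printing Implicit Defensive.

Import Order.TTheory GRing.Theory Num.Theory.
Import numFieldNormedType.Exports.

Local Open Scope classical_set_scope.
Local Open Scope ring_scope.

(** * Inequalities for powers *)

(** No covering numbers of the unit ball are estimated: the code of a function has no prescribed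
    length at any scale, and only the weighted total of its answers is controlled. The link at scale
    [u_n] depends on the whole code down to that scale, so code lengths, not just new answers, have
    to be summed; the weights decay geometrically, and this costs a factor 2.

    An answer costs the logarithm of the number of possible answers, of order [log m], and the
    deviation is spread over order [log m] scales. This is the origin of [(log m)^2], which is at
    most a multiple of [(log m)^p] because [p >= 2]; Clarkson's inequality also rests on [p >= 2].

    The variances contain the empirical sums of [|f|^p], which are the very quantities to be
    estimated. They are at most [m (1 + Z)], and the factor [1 / E] in front lets the [Z] on the
    right be absorbed once [E >= E0]. With [t = D (log m)^2 / m], the value [E = t^(-1/p)] balances
    [1 / E] against [E^(p-1) t]: both equal [t^(1/p)], the second term of the theorem. *)

Section powR_inequalities.
Context {R : realType}.
Implicit Types a b x y p : R.

(** Young's inequality for [x] and [1], with exponents [p] and [p / (p - 1)]. *)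
Lemma powR_bernoulli p x : 1 < p -> 0 <= x -> p * x <= x `^ p + (p - 1).
Proof.
move=> p1 x0.
have p0 : 0 < p by rewrite (lt_trans _ p1).
have q0 : 0 < p / (p - 1) by rewrite divr_gt0 ?subr_gt0.
have pn : p != 0 by rewrite gt_eqF.
have p1n : p - 1 != 0 by rewrite gt_eqF ?subr_gt0.
have pq : p^-1 + (p / (p - 1))^-1 = 1.
  by field; rewrite pn p1n.
have := conjugate_powR x0 (@ler01 R) p0 q0 pq.
rewrite mulr1 powR1 => h.
rewrite mulrC -ler_pdivlMr//.
apply: (le_trans h); rewrite le_eqVlt; apply/orP; left; apply/eqP.
by field; rewrite pn p1n.
Qed.

(** The mean value bound without derivatives: for [y < x], apply Bernoulli's inequality to
    [y / x]. *)
Lemma powR_lipschitz p b x y : 1 < p -> 0 <= x -> 0 <= y -> x <= b -> y <= b ->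
  `|x `^ p - y `^ p| <= p * b `^ (p - 1) * `|x - y|.
Proof.
move=> p1; wlog xy : x y / y <= x.
  move=> H x0 y0 xb yb; have [yx|/ltW xy] := leP y x; first exact: H.
  by rewrite distrC (distrC x); exact: H.
move=> x0 y0 xb yb.
have p0 : 0 < p by rewrite (lt_trans _ p1).
have b0 : 0 <= b by rewrite (le_trans x0).
have xyp : y `^ p <= x `^ p by rewrite ge0_ler_powR// ltW.
rewrite !ger0_norm ?subr_ge0//.
move: xy x0 xb; rewrite le_eqVlt => /predU1P[->|xy] x0 xb.
  by rewrite !subrr mulr0.
have xgt : 0 < x by rewrite (le_lt_trans y0).
have -> : y = x * (y / x) by rewrite mulrC divfK ?gt_eqF.
rewrite powRM// ?divr_ge0//.
have h : p * (y / x) <= (y / x) `^ p + (p - 1) by rewrite powR_bernoulli ?divr_ge0.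
have : x `^ p - x `^ p * (y / x) `^ p <= x `^ p * (p * (1 - y / x)).
  rewrite -{1}[x `^ p]mulr1 -mulrBr ler_wpM2l ?powR_ge0//.
  by move: h; move: (y / x) => z; nra.
move=> /le_trans; apply.
rewrite -(mulr_powRB1 x0 p0).
have yx1 : 0 <= 1 - y / x by rewrite subr_ge0 ler_pdivrMr ?mul1r// ltW.
have -> : x * x `^ (p - 1) * (p * (1 - y / x)) = p * x `^ (p - 1) * (x - x * (y / x)) by ring.
apply: ler_wpM2r; first by rewrite -{1}[x]mulr1 -mulrBr mulr_ge0.
by rewrite ler_wpM2l ?(ltW p0)// ge0_ler_powR ?nnegrE ?subr_ge0 ?(ltW p1).
Qed.

(** After division by [x + y] both terms lie in [[0, 1]], where the power [r >= 1] only decreases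
    them. *)
Lemma powR_superadditive r x y : 1 <= r -> 0 <= x -> 0 <= y ->
  x `^ r + y `^ r <= (x + y) `^ r.
Proof.
move=> r1 x0 y0.
have r0 : 0 < r by rewrite (lt_le_trans _ r1).
have [s0|s0] := eqVneq (x + y) 0.
  have xe : x = 0 by lra.
  have ye : y = 0 by lra.
  by rewrite xe ye !addr0 powR0 ?gt_eqF// addr0.
have s1 : 0 < x + y by rewrite lt0r s0 addr_ge0.
have st : forall z, 0 <= z -> z <= x + y -> z `^ r <= (x + y) `^ r * (z / (x + y)).
  move=> z z0 zs.
  have zs0 : 0 <= z / (x + y) by rewrite divr_ge0 ?(ltW s1).
  rewrite -{1}(divfK s0 z) mulrC powRM ?(ltW s1)//.
  rewrite ler_wpM2l ?powR_ge0//.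
  have [->|zn] := eqVneq (z / (x + y)) 0; first by rewrite powR0 ?gt_eqF.
  apply: ge1r_powR => //.
  by rewrite lt0r zn zs0/= ler_pdivrMr ?mul1r.
apply: (le_trans (lerD (st _ x0 _) (st _ y0 _))); try lra.
by rewrite -mulrDr -mulrDl divff// mulr1.
Qed.

Lemma powR_midpoint r x y : 1 <= r -> 0 <= x -> 0 <= y ->
  ((x + y) / 2) `^ r <= (x `^ r + y `^ r) / 2.
Proof.
move=> r1 x0 y0.
have h0 : (0 : R) <= 2^-1 by lra.
have h1 : (2^-1 : R) <= 1 by lra.
have := @convex_powR R r r1 (Itv01 h0 h1) x y.
rewrite !inE/= !in_itv/= !andbT => /(_ x0 y0).
rewrite convRE [X in X `^ _ <= _ -> _]convRE/=.
have -> : unstable.onem 2^-1 = (2^-1 : R) by rewrite /unstable.onem; lra.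
by rewrite -!mulrDr ![2^-1 * _]mulrC.
Qed.

(** Written with squares and the exponent [p / 2 >= 1]: superadditivity merges the two terms on the
    left, the parallelogram identity turns them into the mean of [x^2] and [y^2], and convexity
    concludes. *)
Lemma powR_clarkson p x y : 2 <= p ->
  `|(x + y) / 2| `^ p + `|(x - y) / 2| `^ p <= (`|x| `^ p + `|y| `^ p) / 2.
Proof.
move=> p2.
have r1 : 1 <= p / 2 by lra.
have E z : `|z| `^ p = (z ^+ 2) `^ (p / 2).
  rewrite -(real_normK (num_real z)) -powR_mulrn ?normr_ge0// -powRrM; congr (_ `^ _).
  by field.
rewrite !E.
apply: (le_trans (powR_superadditive r1 _ _)); rewrite ?sqr_ge0//.
apply: le_trans (powR_midpoint r1 _ _); rewrite ?sqr_ge0//.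
by apply: ge0_ler_powR; rewrite ?nnegrE ?divr_ge0 ?addr_ge0 ?sqr_ge0//; lra.
Qed.

End powR_inequalities.

(** * Coding by minimal-norm candidates *)

Definition midpoint (R : realType) (T : Type) (g h : T -> R) : T -> R :=
  fun t => (g t + h t) / 2.

Section version_spaces.
Context {R : realType} {T : Type} (Q m : nat) (x : 'I_m -> T).
Context (L : set (T -> R)) (Np : (T -> R) -> R) (u delta : nat -> R).

(* Only meaningful for nonempty [V]; exact minimizers need not exist here. *)
Definition near_minimizer (tau : R) (V : set (T -> R)) : T -> R :=
  xget (fun=> 0) [set g | V g /\ forall h, V h -> Np g <= Np h + tau].

(** The scale is stored in every answer so that the part of a code concerning coarser scales can be
    recovered by filtering. The boolean is [true] for a negative difference. *)
Definition query := ('I_Q * 'I_m * bool)%type.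

Definition version_step (V : set (T -> R)) (i : query) : set (T -> R) :=
  [set h | V h /\ u i.1.1 <= (-1) ^+ i.2 *
    (h (x i.1.2) - near_minimizer (delta i.1.1 / 2) V (x i.1.2))].

Definition version_space (w : seq query) : set (T -> R) := foldl version_step L w.

Definition approximant (n : nat) (w : seq query) : T -> R :=
  near_minimizer (delta n / 2) (version_space w).

Hypothesis L_mid : forall g h, L g -> L h -> L (midpoint g h).
Hypothesis Np_ge0 : forall f, L f -> 0 <= Np f.
Hypothesis delta_gt0 : forall n, 0 < delta n.
Hypothesis Np_mid : forall n g h t, L g -> L h -> u n <= `|g t - h t| ->
  Np (midpoint g h) + delta n <= (Np g + Np h) / 2.

Lemma near_minimizerP tau V f : 0 < tau -> V `<=` L -> V f ->
  V (near_minimizer tau V) /\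
  forall h, V h -> Np (near_minimizer tau V) <= Np h + tau.
Proof.
move=> tau0 VL Vf.
have hinf : has_inf [set Np h | h in V].
  split; first by exists (Np f), f.
  by exists 0 => _ [h Vh <-]; exact/Np_ge0/VL.
have [_ [g Vg <-] gtau] := inf_adherent tau0 hinf.
have : [set g | V g /\ forall h, V h -> Np g <= Np h + tau] g.
  split=> // h Vh; apply: (le_trans (ltW gtau)); rewrite lerD2r.
  by apply: (ge_inf hinf.2); exists h.
by move=> /(@xgetI _ (fun=> 0)).
Qed.

Lemma version_space_rcons w i :
  version_space (rcons w i) = version_step (version_space w) i.
Proof. by rewrite /version_space foldl_rcons. Qed.

Lemma version_space_sub w : version_space w `<=` L.
Proof.
elim/last_ind: w => [//|w i IH] h.
by rewrite version_space_rcons => -[/IH].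
Qed.

(** Every answer restricts the value at one point to a half-line, so convexity of [L] is
    inherited. *)
Lemma version_space_mid w g h : version_space w g -> version_space w h ->
  version_space w (midpoint g h).
Proof.
elim/last_ind: w => [|w i IH]; first exact: L_mid.
rewrite version_space_rcons => -[Vg ug] [Vh uh]; split; first exact: IH.
by rewrite /midpoint; move: ug uh; case: i.2; rewrite ?expr1 ?expr0; lra.
Qed.

(* Uniform convexity: the norm of the minimizer increases at every query. *)
Lemma version_space_gain w i v :
  (forall h, version_space w h -> v <= Np h) ->
  forall h, version_space (rcons w i) h -> v + delta i.1.1 <= Np h.
Proof.
move=> lbv h; rewrite version_space_rcons => -[Vh uh].
have tau0 : 0 < delta i.1.1 / 2 by rewrite divr_gt0.
have [] := near_minimizerP tau0 (@version_space_sub w) Vh.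
set g := near_minimizer _ _ in uh * => Vg gmin.
have ugh : u i.1.1 <= `|g (x i.1.2) - h (x i.1.2)|.
  apply: (le_trans uh); rewrite distrC (le_trans (ler_norm _))//.
  by rewrite normrM normrX normrN1 expr1n mul1r.
(* Convexity gives [Np h >= 2 Np(midpoint) - Np g + 2 delta]; the slack [delta / 2] of the near
   minimizer uses up one of these two [delta]. *)
have := Np_mid (version_space_sub Vg) (version_space_sub Vh) ugh.
have := gmin _ (version_space_mid Vg Vh).
have := lbv _ Vg; lra.
Qed.

(** The questions at one scale come to an end because each answer raises the lower bound [v] by
    [delta n], while [f] stays in the version space and keeps [v <= Np f]. The last clause is stated
    for every [v] so that the gains of successive scales can be added. *)
Lemma version_space_refine (n : 'I_Q) w f : version_space w f ->
  exists w', [/\ all (fun i : query => i.1.1 == n) w', version_space (w ++ w') f,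
    (forall j, `|f (x j) - approximant n (w ++ w') (x j)| <= u n) &
    forall v, (forall h, version_space w h -> v <= Np h) ->
      forall h, version_space (w ++ w') h -> v + (size w')%:R * delta n <= Np h].
Proof.
move=> Vf0.
have [k kP] : exists k : nat, Np f < 0 + k%:R * delta n.
  exists (Num.truncn (Np f / delta n)).+1.
  rewrite add0r -ltr_pdivrMr//.
  by rewrite truncnS_gt.
have lb0 h : version_space w h -> 0 <= Np h by move=> /version_space_sub/Np_ge0.
elim: k w Vf0 0 kP lb0 => [|k IH] w Vf v kP lbv.
  by have := lbv _ Vf; rewrite mul0r addr0 in kP; lra.
have [close|] := pselect (forall j, `|f (x j) - approximant n w (x j)| <= u n).
  exists [::]; rewrite cats0; split=> //= v' lb' h /lb'.
  by rewrite mul0r addr0.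
move=> /existsNP[j /negP]; rewrite -ltNge => uj.
pose i : query := (n, j, f (x j) - approximant n w (x j) < 0).
have Vf1 : version_space (rcons w i) f.
  rewrite version_space_rcons; split=> //=; rewrite -/(approximant n w).
  move: uj; case: (ltP (f (x j) - _) 0) => d0; rewrite ?expr1 ?expr0 ?mul1r ?mulN1r => /ltW.
    by rewrite ltr0_norm.
  by rewrite ger0_norm.
have kP1 : Np f < v + delta n + k%:R * delta n.
  by move: kP; rewrite -natr1 mulrDl mul1r; lra.
have [w' [tw Vw clw gw]] := IH _ Vf1 _ kP1 (version_space_gain lbv).
exists (i :: w'); rewrite -cat_rcons; split=> //=.
  by rewrite eqxx tw.
move=> v' lb' h Vh; have := gw _ (version_space_gain lb') h Vh => /=.
by rewrite -natr1 mulrDl mul1r; lra.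
Qed.

(** The gains of all scales are charged to the single quantity [Np f]. Since [W n] is a function of
    [W n.+1], a link between two consecutive scales is determined by one word, as the union bound
    requires. *)
Lemma version_space_chain f : L f ->
  exists (W : nat -> seq query) (k : nat -> nat),
  [/\ W 0 = [::],
    forall n, (n < Q)%N -> W n = [seq i : query <- W n.+1 | (i.1.1 < n)%N],
    forall n, (n < Q)%N -> size (W n.+1) = (size (W n) + k n)%N,
    forall n, (n < Q)%N -> forall j, `|f (x j) - approximant n (W n.+1) (x j)| <= u n &
    \sum_(n < Q) (k n)%:R * delta n <= Np f].
Proof.
move=> Lf.
have [step stepP] : exists step : 'I_Q -> seq query -> seq query, forall n w,
    version_space w f -> [/\ all (fun i : query => i.1.1 == n) (step n w),
    version_space (w ++ step n w) f,
    (forall j, `|f (x j) - approximant n (w ++ step n w) (x j)| <= u n) &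
    forall v, (forall h, version_space w h -> v <= Np h) ->
      forall h, version_space (w ++ step n w) h ->
        v + (size (step n w))%:R * delta n <= Np h].
  have H (nw : 'I_Q * seq query) : exists w', version_space nw.2 f ->
    [/\ all (fun i : query => i.1.1 == nw.1) w', version_space (nw.2 ++ w') f,
    (forall j, `|f (x j) - approximant nw.1 (nw.2 ++ w') (x j)| <= u nw.1) &
    forall v, (forall h, version_space nw.2 h -> v <= Np h) ->
      forall h, version_space (nw.2 ++ w') h -> v + (size w')%:R * delta nw.1 <= Np h].
    have [/(version_space_refine nw.1)[w' w'P]|nV] := pselect (version_space nw.2 f).
      by exists w'.
    by exists [::].
  have [s sP] := choice H.
  by exists (fun n w => s (n, w)) => n w; exact: sP (n, w).
pose add n w := if insub n is Some n' then step n' w else [::].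
pose W := fix W n := if n is n'.+1 then W n' ++ add n' (W n') else [::].
have addE n (nQ : (n < Q)%N) w : add n w = step (Ordinal nQ) w.
  by rewrite /add insubT.
have WS n : W n.+1 = W n ++ add n (W n) by [].
have VW n : (n <= Q)%N -> version_space (W n) f.
  elim: n => [//|n IH] nQ; rewrite WS (addE _ nQ).
  by case: (stepP (Ordinal nQ) (W n) (IH (ltnW nQ))).
have tagW n : (n <= Q)%N -> all (fun i : query => (i.1.1 < n)%N) (W n).
  elim: n => [//|n IH] nQ; rewrite WS all_cat (addE _ nQ); apply/andP; split.
    by apply: sub_all (IH (ltnW nQ)) => i /ltnW.
  case: (stepP (Ordinal nQ) (W n) (VW _ (ltnW nQ))) => + _ _ _.
  by apply: sub_all => i /eqP ->.
exists W, (fun n => size (add n (W n))); split=> //.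
- move=> n nQ; rewrite WS filter_cat (addE _ nQ).
  rewrite (all_filterP (tagW _ (ltnW nQ))).
  case: (stepP (Ordinal nQ) (W n) (VW _ (ltnW nQ))) => + _ _ _.
  move=> tn; rewrite (eq_in_filter (a2 := pred0)) ?filter_pred0 ?cats0//.
  by move=> i /(allP tn)/eqP -> /=; rewrite ltnn.
- by move=> n nQ; rewrite WS size_cat.
- move=> n nQ; rewrite WS (addE _ nQ).
  by case: (stepP (Ordinal nQ) (W n) (VW _ (ltnW nQ))).
have gain N : (N <= Q)%N -> forall h, version_space (W N) h ->
    \sum_(n < N) (size (add n (W n)))%:R * delta n <= Np h.
  elim: N => [_ h Vh|N IH NQ h].
    by rewrite big_ord0; exact/Np_ge0/(version_space_sub Vh).
  rewrite WS big_ord_recr/= (addE _ NQ) => Vh.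
  have [_ _ _ /(_ _ (IH (ltnW NQ)))] := stepP (Ordinal NQ) (W N) (VW _ (ltnW NQ)).
  exact.
exact: gain (leqnn Q) _ (VW _ (leqnn Q)).
Qed.

End version_spaces.

(** * Truncated powers and chaining links *)

Section truncated_powers.
Context {R : realType} (p : R) (p2 : 2 <= p).
Implicit Types b c u y z E : R.

Definition tpow b z : R := Num.min `|z| b `^ p.

Let p1 : 1 < p. Proof. by rewrite (lt_le_trans _ p2)// ltr1n. Qed.
Let p0 : 0 < p. Proof. by rewrite (lt_trans _ p1). Qed.

Lemma tpow_ge0 b z : 0 <= tpow b z. Proof. exact: powR_ge0. Qed.

Lemma tpow_small b z : `|z| <= b -> tpow b z = `|z| `^ p.
Proof. by move=> zb; rewrite /tpow min_l. Qed.

Lemma min_norm_ge0 b z : 0 <= b -> 0 <= Num.min `|z| b.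
Proof. by move=> b0; rewrite le_min normr_ge0. Qed.

Lemma tpow_le b b' z : 0 <= b -> b <= b' -> tpow b z <= tpow b' z.
Proof.
move=> b0 bb'; apply: ge0_ler_powR; rewrite ?nnegrE ?min_norm_ge0 ?(ltW p0)//.
  exact: le_trans bb'.
by rewrite le_min ge_min lexx/= ge_min bb' orbT.
Qed.

Lemma tpow_bound b z : 0 <= b -> tpow b z <= b `^ p.
Proof.
move=> b0; apply: ge0_ler_powR; rewrite ?nnegrE ?min_norm_ge0 ?(ltW p0)//.
by rewrite ge_min lexx orbT.
Qed.

(** The Lipschitz constant is governed by the truncated values themselves, which may be far below
    the cutoff [b]; the variance bound for links depends on this. *)
Lemma tpow_lipschitz b c y z : 0 <= b -> Num.min `|y| b <= c -> Num.min `|z| b <= c ->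
  `|tpow b y - tpow b z| <= p * c `^ (p - 1) * `|y - z|.
Proof.
move=> b0 yc zc.
apply: (le_trans (powR_lipschitz p1 _ _ yc zc)); rewrite ?min_norm_ge0//.
rewrite ler_wpM2l ?mulr_ge0 ?powR_ge0 ?(ltW p0)//.
apply: (@le_trans _ _ `| `|y| - `|z| |); last exact: ler_dist_dist.
have h1 := ler_norm (`|y| - `|z|).
have h2 := lerNnormlW (lexx `| `|y| - `|z| |).
rewrite ler_norml /Num.min.
by case: (ltP `|y| b) => hy; case: (ltP `|z| b) => hz; apply/andP; split; lra.
Qed.

(* Contribution of the scale [u] to [|y|^p], from approximations [z] and [z'] of
   [y] at the scales [u] and [2 u]. It vanishes when [|y| <= u], and the
   increment from [z'] to [z] is cut off at the height [E u]. *)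
Definition link E u z z' : R :=
  (tpow (E * u) z - tpow (2 * u) z) - (tpow (E * u) z' - tpow (4 * u) z').

(** The first summand is the Lipschitz cost of the cut at [E u], where [|z - z'| <= 3 u] and the
    truncated values are at most [3 min(|y|, E u)]. The second covers the truncations at [2 u] and
    [4 u]. *)
Definition link_const : R := 3 * p * 3 `^ (p - 1) + 2 * 4 `^ p.

Lemma link_const_ge0 : 0 <= link_const.
Proof. by rewrite /link_const addr_ge0 ?mulr_ge0 ?powR_ge0 ?(ltW p0). Qed.

(** If [|y| <= u], no truncation is active and the link vanishes. Otherwise [v = min(|y|, E u)] is
    at least [u] and the link is [O(u v^(p-1))]. In its square, [v^(2p-2)] is split as
    [v^(p-2) v^p], with the first factor bounded by [(E u)^(p-2)] and the second by [|y|^p]. *)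
Lemma link_sqr_le E u y z z' : 4 <= E -> 0 < u -> `|y - z| <= u -> `|y - z'| <= 2 * u ->
  link E u z z' ^+ 2 <= link_const ^+ 2 * E `^ (p - 2) * u `^ p * `|y| `^ p.
Proof.
move=> E4 u0 yz yz'.
have zle : `|z| <= `|y| + u.
  by have := ler_normB y (y - z); rewrite opprB addrCA subrr addr0; lra.
have zle' : `|z'| <= `|y| + 2 * u.
  by have := ler_normB y (y - z'); rewrite opprB addrCA subrr addr0; lra.
have Eu : 4 * u <= E * u by rewrite ler_pM2r.
have [yu|uy] := leP `|y| u.
  rewrite /link !tpow_small; [|lra..].
  rewrite !subrr expr0n; apply: mulr_ge0; last exact: powR_ge0.
  by apply: mulr_ge0; [apply: mulr_ge0; [exact: sqr_ge0|]|]; exact: powR_ge0.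
set v := Num.min `|y| (E * u).
have uv : u <= v by rewrite le_min (ltW uy); lra.
have v0 : 0 < v by rewrite (lt_le_trans u0).
have C0 := link_const_ge0.
have upow c : 0 <= c -> c <= 4 -> (c * u) `^ p <= 4 `^ p * (u * v `^ (p - 1)).
  move=> c0 c4; rewrite powRM ?(ltW u0)// ler_pM ?powR_ge0//.
    by rewrite ge0_ler_powR ?nnegrE ?(ltW p0).
  rewrite -(mulr_powRB1 (ltW u0) p0) ler_wpM2l ?(ltW u0)//.
  by rewrite ge0_ler_powR ?nnegrE ?(ltW u0) ?(ltW v0) ?subr_ge0 ?(ltW p1).
have linkle : `|link E u z z'| <= link_const * (u * v `^ (p - 1)).
  have h1 : `|tpow (E * u) z - tpow (E * u) z'| <= 3 * p * 3 `^ (p - 1) * (u * v `^ (p - 1)).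
    have mle s : `|s| <= 3 * `|y| -> Num.min `|s| (E * u) <= 3 * v.
      by move=> hs; rewrite /v /Num.min; case: (ltP `|s|) => ?; case: (ltP `|y|) => ?; lra.
    have mz : Num.min `|z| (E * u) <= 3 * v by apply: mle; lra.
    have mz' : Num.min `|z'| (E * u) <= 3 * v by apply: mle; lra.
    have Eu0 : 0 <= E * u by lra.
    have h := tpow_lipschitz Eu0 mz mz'.
    have zz' : `|z - z'| <= 3 * u.
      by have := ler_normB (y - z') (y - z); rewrite (_ : y - z' - (y - z) = z - z'); [lra|ring].
    apply: (le_trans h).
    rewrite powRM ?(ltW v0)//.
    have : 0 <= p * (3 `^ (p - 1) * v `^ (p - 1)) by rewrite !mulr_ge0 ?powR_ge0 ?(ltW p0).
    by move=> c0; have := ler_wpM2l c0 zz'; lra.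
  have h2 := upow 2 (ltac:(lra)) (ltac:(lra)).
  have h3 := upow 4 (ltac:(lra)) (lexx _).
  have h4 := @tpow_bound (2 * u) z (ltac:(lra)).
  have h5 := @tpow_bound (4 * u) z' (ltac:(lra)).
  have h6 := tpow_ge0 (2 * u) z.
  have h7 := tpow_ge0 (4 * u) z'.
  rewrite /link /link_const.
  move: h1; rewrite !ler_norml => /andP[h1 h1']; apply/andP; split; lra.
rewrite -(real_normK (num_real (link E u z z'))).
have uvp : 0 <= link_const * (u * v `^ (p - 1)) by rewrite !mulr_ge0 ?powR_ge0 ?(ltW u0).
apply: (@le_trans _ _ ((link_const * (u * v `^ (p - 1))) ^+ 2)).
  by rewrite ler_sqr ?nnegrE.
have -> : (link_const * (u * v `^ (p - 1))) ^+ 2 =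
  link_const ^+ 2 * (u ^+ 2 * (v `^ (p - 1)) ^+ 2) by ring.
rewrite -!(mulrA (link_const ^+ 2)); apply: ler_wpM2l; first exact: sqr_ge0.
have -> : v `^ (p - 1) ^+ 2 = v `^ (p - 2) * v `^ p.
  rewrite expr2 -!powRD; first by congr (_ `^ _); ring.
    by rewrite (gt_eqF v0) implybT.
  by rewrite (gt_eqF v0) implybT.
have -> : u `^ p = u ^+ 2 * u `^ (p - 2).
  rewrite -powR_mulrn ?(ltW u0)// -powRD ?(gt_eqF u0) ?implybT//.
  by congr (_ `^ _); ring.
have -> : E `^ (p - 2) * (u ^+ 2 * u `^ (p - 2)) * `|y| `^ p =
    u ^+ 2 * ((E * u) `^ (p - 2) * `|y| `^ p).
  by rewrite powRM ?(ltW u0)//; [ring|lra].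
apply: ler_wpM2l; first exact: sqr_ge0.
apply: ler_pM; rewrite ?powR_ge0//; apply: ge0_ler_powR;
  rewrite ?nnegrE ?(ltW v0) ?subr_ge0 ?(ltW p0)//.
- by lra.
- by rewrite /v ge_min lexx orbT.
- by rewrite /v ge_min lexx.
Qed.

Lemma halving_powR b : 0 <= b -> (b / 2) `^ p <= b `^ p / 2.
Proof.
move=> b0; rewrite powRM// ?invr_ge0//; rewrite ler_wpM2l ?powR_ge0//.
by apply: ge1r_powR; [apply/andP; split; lra | exact: ltW].
Qed.

(** If [|y| <= b / 4], both shells are empty. Otherwise [4 |y|] exceeds [b], so the shell of [4 y]
    has its full size, at least [b^p / 2], and absorbs the Lipschitz error [O(b^p / E)]. Errors in
    this form telescope over the scales. *)
Lemma shell_approx E u b y z : 4 <= E -> 0 < u -> b = E * u -> `|y - z| <= u ->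
  `|(tpow b y - tpow (b / 2) y) - (tpow b z - tpow (b / 2) z)| <=
  4 * p / E * (tpow b (4 * y) - tpow (b / 2) (4 * y)).
Proof.
move=> E4 u0 bE yz.
have b4 : 4 * u <= b by rewrite bE ler_pM2r.
have Egt0 : 0 < E by lra.
have zle : `|z| <= `|y| + u.
  by have := ler_normB y (y - z); rewrite opprB addrCA subrr addr0; lra.
have C0 : 0 <= 4 * p / E by rewrite !mulr_ge0 ?invr_ge0 ?(ltW p0) ?(ltW Egt0).
have [yb|by4] := leP `|y| (b / 4).
  rewrite [tpow b y]tpow_small ?[tpow (b / 2) y]tpow_small ?[tpow b z]tpow_small
    ?[tpow (b / 2) z]tpow_small; try lra.
  rewrite !subrr normr0 mulr_ge0// subr_ge0 tpow_le//; lra.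
have y4 : `|4 * y| = 4 * `|y| by rewrite normrM ger0_norm.
have h1 : tpow b (4 * y) = b `^ p.
  by rewrite /tpow y4 min_r//; lra.
have h2 : tpow (b / 2) (4 * y) <= b `^ p / 2.
  by apply: le_trans (halving_powR _); [apply: tpow_bound|]; lra.
have bp : u * b `^ (p - 1) = b `^ p / E.
  have bge : 0 <= b by lra.
  by rewrite -(mulr_powRB1 bge p0) {2}bE; field; rewrite gt_eqF.
have lip c : 0 <= c -> c <= b -> `|tpow c y - tpow c z| <= p * b `^ p / E.
  move=> c0 cb.
  have h := @tpow_lipschitz c b y z c0 _ _.
  apply: (le_trans (h _ _)); try by rewrite ge_min cb orbT.
  rewrite -!mulrA -bp; apply: ler_wpM2l; first exact: ltW.
  by rewrite mulrC ler_wpM2r// powR_ge0.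
have l1 := lip b (ltac:(lra)) (lexx _).
have l2 := lip (b / 2) (ltac:(lra)) (ltac:(lra)).
have h3 : 4 * p / E * (b `^ p / 2) <= 4 * p / E * (tpow b (4 * y) - tpow (b / 2) (4 * y)).
  by apply: ler_wpM2l => //; lra.
apply: le_trans h3.
have -> : 4 * p / E * (b `^ p / 2) = 2 * (p * b `^ p / E) by field; rewrite gt_eqF.
move: l1 l2; rewrite !ler_norml => /andP[? ?] /andP[? ?]; apply/andP; split; lra.
Qed.

Lemma chaining_approx E K (z : nat -> R) y Q : 4 <= E -> 0 < K ->
  z 0 = 0 -> `|y| <= K -> (forall k, (k < Q)%N -> `|y - z k.+1| <= K / 2 ^+ k.+1) ->
  `| `|y| `^ p - \sum_(k < Q) link E (K / 2 ^+ k.+1) (z k.+1) (z k) | <=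
    4 * p * 4 `^ p / E * `|y| `^ p + (E * (K / 2 ^+ Q.+1)) `^ p.
Proof.
move=> E4 K0 z0 yK close.
pose u k : R := K / 2 ^+ k.
have Egt0 : 0 < E by lra.
have u0 k : 0 < u k by rewrite divr_gt0 ?exprn_gt0.
have uS k : u k = 2 * u k.+1.
  by rewrite /u exprS; field; rewrite expf_neq0// pnatr_eq0.
have C0 : 0 <= 4 * p / E by rewrite !mulr_ge0 ?invr_ge0 ?(ltW p0) ?(ltW Egt0).
have bS k : E * u k.+1 / 2 = E * u k.+2 by rewrite (uS k.+1); field.
(* Regrouped by approximant, using [2 u_(k+1) = 4 u_(k+2)], the links give each [z k] with [k >= 1]
   its shell between the heights [E u_(k+1)] and [E u_k], which is then replaced by the shell of
   [y]. The bracket with [z N] is the boundary term of this summation. *)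
have main N : (N <= Q)%N ->
  `|tpow (E * u 1%N) y - \sum_(k < N) link E (u k.+1) (z k.+1) (z k) -
    (tpow (E * u N.+1) y - (tpow (E * u N.+1) (z N) - tpow (4 * u N.+1) (z N)))| <=
  4 * p / E * (tpow (E * u 1%N) (4 * y) - tpow (E * u N.+1) (4 * y)).
  elim: N => [_|N IH NQ].
    rewrite big_ord0 subr0 z0.
    have t0 c : 0 < c -> tpow c 0 = 0.
      by move=> c0; rewrite tpow_small normr0 ?powR0 ?gt_eqF// ltW.
    by rewrite !t0 ?mulr_gt0// !subrr subr0 subrr normr0 mulr0.
  have := shell_approx E4 (u0 N.+1) erefl (close _ NQ).
  rewrite bS => h.
  have -> : 4 * p / E * (tpow (E * u 1%N) (4 * y) - tpow (E * u N.+2) (4 * y)) =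
    4 * p / E * (tpow (E * u 1%N) (4 * y) - tpow (E * u N.+1) (4 * y)) +
    4 * p / E * (tpow (E * u N.+1) (4 * y) - tpow (E * u N.+2) (4 * y)) by ring.
  apply: le_trans (lerD (IH (ltnW NQ)) h).
  apply: le_trans (ler_normD _ _); rewrite le_eqVlt; apply/orP; left; apply/eqP.
  congr `| _ |; rewrite big_ord_recr/= /link.
  have -> : 2 * u N.+1 = 4 * u N.+2 by rewrite (uS N.+1); ring.
  ring.
have := main _ (leqnn Q).
(* The topmost cutoff is inactive, so the sum starts from [|y|^p] itself. *)
have yb : `|y| <= E * u 1%N.
  have : u 0 = K by rewrite /u expr0 divr1.
  by rewrite (uS 0) => ?; nra.
rewrite [tpow _ y]tpow_small// => h.
have bQ0 : 0 <= E * u Q.+1 by rewrite mulr_ge0 ?ltW.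
have aQ0 : 0 <= 4 * u Q.+1 by rewrite mulr_ge0 ?ltW.
have t1 := tpow_ge0 (E * u Q.+1) y.
have t2 := tpow_bound y bQ0.
have t3 := tpow_bound (z Q) bQ0.
have t4 := tpow_ge0 (4 * u Q.+1) (z Q).
have t5 : tpow (4 * u Q.+1) (z Q) <= tpow (E * u Q.+1) (z Q).
  by apply: tpow_le => //; rewrite ler_pM2r.
have h2 : 4 * p / E * (tpow (E * u 1%N) (4 * y) - tpow (E * u Q.+1) (4 * y)) <=
    4 * p * 4 `^ p / E * `|y| `^ p.
  have -> : 4 * p * 4 `^ p / E * `|y| `^ p = 4 * p / E * (4 `^ p * `|y| `^ p) by ring.
  apply: ler_wpM2l => //.
  have -> : 4 `^ p * `|y| `^ p = `|4 * y| `^ p.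
    by rewrite normrM ger0_norm// powRM.
  have := tpow_ge0 (E * u Q.+1) (4 * y).
  have : tpow (E * u 1%N) (4 * y) <= `|4 * y| `^ p.
    apply: ge0_ler_powR; rewrite ?nnegrE ?min_norm_ge0 ?(ltW p0)//.
      by rewrite mulr_ge0 ?ltW.
    by rewrite ge_min lexx.
  lra.
move: h; rewrite -/(u _) !ler_norml => /andP[? ?]; apply/andP; split; lra.
Qed.

End truncated_powers.

(** * Random signs *)

Section sign_averages.
Context {R : realType}.

(** For [|x| >= 1/2] both exponents are at most [2 x^2]. For smaller [x], [expR x <= 1 / (1 - x)]
    bounds the sum by [2 / (1 - x^2)]. *)
Lemma cosh_le (x : R) : expR x + expR (- x) <= 2 * expR (2 * x ^+ 2).
Proof.
have sq : `|x| ^+ 2 = x ^+ 2 by rewrite real_normK ?num_real.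
have h1 := ler_norm x; have h2 := ler_norm (- x); rewrite normrN in h2.
have n0 := normr_ge0 x.
have [big|small] := leP (1 / 2) `|x|.
  have xx : `|x| <= 2 * x ^+ 2 by rewrite -sq; nra.
  have e1 : expR x <= expR (2 * x ^+ 2) by rewrite ler_expR (le_trans h1).
  have e2 : expR (- x) <= expR (2 * x ^+ 2) by rewrite ler_expR (le_trans h2).
  lra.
have x2 : x ^+ 2 < 1 / 4 by rewrite -sq; nra.
have bound (y : R) : `|y| < 1 / 2 -> expR y <= (1 - y)^-1.
  move=> ysmall; have y1 : 0 < 1 - y by have := ler_norm y; lra.
  rewrite -[y in expR y]opprK expRN lef_pV2 ?posrE ?expR_gt0//.
  exact: expR_ge1Dx.
have e1 := bound x small.
have e2 : expR (- x) <= (1 - - x)^-1 by apply: bound; rewrite normrN.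
have e3 := expR_ge1Dx (2 * x ^+ 2).
apply: (le_trans (lerD e1 e2)); apply: (@le_trans _ _ (2 * (1 + 2 * x ^+ 2))).
  have -> : (1 - x)^-1 + (1 - - x)^-1 = 2 / (1 - x ^+ 2).
    by field; apply/andP; split; [|apply/andP; split]; apply/eqP; nra.
  rewrite ler_pdivrMr; last by lra.
  have := sqr_ge0 x; nra.
by rewrite ler_wpM2l.
Qed.

Section fixed_size.
Context {m : nat}.
Local Notation signs := {ffun 'I_m -> bool}.

Definition signed_sum (s : signs) (a : 'I_m -> R) : R := \sum_(j < m) (-1) ^+ s j * a j.

Lemma signed_sumZ s c a : signed_sum s (fun j => c * a j) = c * signed_sum s a.
Proof. by rewrite mulr_sumr; apply: eq_bigr => j _; rewrite mulrCA. Qed.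

Lemma sum_expR_signed (a : 'I_m -> R) :
  \sum_(s : signs) expR (signed_sum s a) <= 2 ^+ m * expR (2 * \sum_(j < m) a j ^+ 2).
Proof.
under eq_bigr do rewrite /signed_sum expR_sum.
rewrite -(bigA_distr_bigA (fun j b => expR ((-1) ^+ nat_of_bool b * a j)))/=.
have -> : 2 ^+ m * expR (2 * \sum_(j < m) a j ^+ 2) = \prod_(j < m) (2 * expR (2 * a j ^+ 2)).
  rewrite big_split/= prodr_const card_ord; congr (_ * _).
  by rewrite mulr_sumr expR_sum.
apply: ler_prod => j _; rewrite big_bool/= expr1 expr0 mul1r mulN1r.
by rewrite addr_ge0 ?expR_ge0//= addrC cosh_le.
Qed.

(** With the variance inside the exponent the bound is the same for all vectors, so vectors of very
    different sizes can share one union bound. *)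
Lemma sum_expR_self_normalized (a : 'I_m -> R) :
  \sum_(s : signs) expR (signed_sum s a - 2 * \sum_(j < m) a j ^+ 2) <= 2 ^+ m.
Proof.
under eq_bigr do rewrite expRD.
rewrite -mulr_suml expRN ler_pdivrMr ?expR_gt0//.
exact: sum_expR_signed.
Qed.

(** One function [G] of the signs, bounded on average, serves all words, and each word pays for its
    own length instead of a maximal one. The length limit [l] only makes the defining sum finite and
    does not enter the estimate. *)
Lemma signed_union_bound (A : finType) (psi : seq A -> 'I_m -> R) (l : nat) (lam : R) :
  (0 < #|A|)%N -> 0 <= lam ->
  exists G : signs -> R, [/\ forall s, 0 <= G s, \sum_s G s <= 4 * 2 ^+ m &
    forall s w, (size w < l)%N ->
      lam * `|signed_sum s (psi w)| <=
      2 * lam ^+ 2 * \sum_(j < m) psi w j ^+ 2 + (size w)%:R * ln (2 * #|A|%:R) + G s].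
Proof.
move=> A0 lam0.
(* Words of size [k] get the weight [al ^- k], whose total mass is at most [2]. *)
pose al : R := 2 * #|A|%:R.
have al0 : 0 < al by rewrite mulr_gt0// ltr0n.
pose e c s (w : seq A) : R := expR (signed_sum s (fun j => c * psi w j) -
   2 * \sum_(j < m) (c * psi w j) ^+ 2).
have sq c (w : seq A) : \sum_(j < m) (c * psi w j) ^+ 2 = c ^+ 2 * \sum_(j < m) psi w j ^+ 2.
  by rewrite mulr_sumr; apply: eq_bigr => j _; rewrite exprMn.
pose G s := \sum_(k < l) \sum_(w : k.-tuple A) al ^- k * (e lam s w + e (- lam) s w).
have t0 s k (w : seq A) : 0 <= al ^- k * (e lam s w + e (- lam) s w).
  by rewrite mulr_ge0 ?invr_ge0 ?exprn_ge0 ?addr_ge0 ?expR_ge0 ?(ltW al0).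
exists G; split.
- by move=> s; apply: sumr_ge0 => k _; apply: sumr_ge0 => w _; exact: t0.
- rewrite exchange_big/=.
  have half k : \sum_(s : signs) \sum_(w : k.-tuple A) al ^- k * (e lam s w + e (- lam) s w) <=
      2 ^- k * (2 * 2 ^+ m).
    rewrite exchange_big/=.
    apply: (@le_trans _ _ (\sum_(w : k.-tuple A) al ^- k * (2 * 2 ^+ m))).
      apply: ler_sum => w _; rewrite -mulr_sumr big_split/= ler_wpM2l//.
        by rewrite invr_ge0 exprn_ge0 ?ltW.
      by rewrite mulr_natl mulr2n lerD ?sum_expR_self_normalized.
    rewrite sumr_const card_tuple -[leLHS]mulr_natr natrX /al exprMn.
    rewrite le_eqVlt; apply/orP; left; apply/eqP; field.
    by rewrite !expf_neq0// pnatr_eq0 -lt0n.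
  apply: (@le_trans _ _ (\sum_(k < l) 2 ^- k * (2 * 2 ^+ m))).
    by apply: ler_sum => k _; exact: half.
  rewrite -mulr_suml.
  have : \sum_(k < l) 2 ^- k <= 2 - 2 ^- l * 2 :> R.
    elim: (l) => [|n IH]; first by rewrite big_ord0 expr0 invr1; lra.
    rewrite big_ord_recr/= exprS invfM; lra.
  have : 0 <= 2 ^- l :> R by rewrite invr_ge0 exprn_ge0.
  have : 0 <= 2 ^+ m :> R by rewrite exprn_ge0.
  move: (2 ^+ m) (2 ^- l) (\sum_(k < l) _) => M h S; nra.
move=> s w wl.
have Gw : al ^- size w * (e lam s w + e (- lam) s w) <= G s.
  rewrite /G (bigD1 (Ordinal wl))//= (bigD1 (in_tuple w))//=.
  rewrite -addrA lerDl addr_ge0//; apply: sumr_ge0 => *; [exact: t0|].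
  by apply: sumr_ge0 => *; exact: t0.
have alE : al ^- size w = expR (- ((size w)%:R * ln al)).
  by rewrite expRN mulrC expRM_natr lnK.
rewrite -/al; have [S0|S0] := leP 0 (signed_sum s (psi w)).
  have : al ^- size w * e lam s w <= G s.
    apply: le_trans Gw; rewrite ler_wpM2l ?invr_ge0 ?exprn_ge0 ?(ltW al0)//.
    by rewrite lerDl expR_ge0.
  rewrite alE /e -expRD signed_sumZ sq.
  (* A single term of [G] is an exponential, and [1 + x <= expR x] bounds its exponent by [G s]. *)
  by move=> /(le_trans (expR_ge1Dx _)); rewrite (ger0_norm S0); lra.
have : al ^- size w * e (- lam) s w <= G s.
  apply: le_trans Gw; rewrite ler_wpM2l ?invr_ge0 ?exprn_ge0 ?(ltW al0)//.
  by rewrite lerDr expR_ge0.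
rewrite alE /e -expRD signed_sumZ sq sqrrN.
by move=> /(le_trans (expR_ge1Dx _)); rewrite (ltr0_norm S0); lra.
Qed.

End fixed_size.
End sign_averages.

(** * The chaining bound for fixed points *)

Section chaining.
Context {R : realType}.

(** [S n.+1] is the length of the code used at scale [n]. The induction keeps [2 * S n * delta n] in
    reserve: halving [delta] frees just enough to pay for the whole code at the next scale. *)
Lemma sum_partial_sums_le (delta : nat -> R) (S k : nat -> nat) (N : nat) :
  (forall n, 0 <= delta n) -> (forall n, delta n.+1 <= delta n / 2) -> S 0 = 0%N ->
  (forall n, (n < N)%N -> S n.+1 = (S n + k n)%N) ->
  \sum_(n < N) (S n.+1)%:R * delta n <= 2 * \sum_(n < N) (k n)%:R * delta n.
Proof.
move=> d0 dS S0 SS.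
suff H n : (n <= N)%N -> \sum_(i < n) (S i.+1)%:R * delta i + 2 * ((S n)%:R * delta n) <=
    2 * \sum_(i < n) (k i)%:R * delta i.
  have := H _ (leqnn N); have : 0 <= (S N)%:R * delta N by rewrite mulr_ge0.
  lra.
elim: n => [_|n IH nN]; first by rewrite !big_ord0 S0 mul0r !mulr0 addr0.
rewrite !big_ord_recr/=.
have h := IH (ltnW nN).
have hS : (S n.+1)%:R * delta n.+1 <= (S n.+1)%:R * (delta n / 2) by rewrite ler_wpM2l.
have e : (S n.+1)%:R * delta n = (S n)%:R * delta n + (k n)%:R * delta n.
  by rewrite SS// natrD mulrDl.
have e' : (S n.+1)%:R * (delta n / 2) = (S n.+1)%:R * delta n / 2 by rewrite mulrA.
lra.
Qed.

Lemma geometric_sum_le (delta : nat -> R) (c : R) (N : nat) :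
  (forall n, 0 <= delta n) -> (forall n, delta n.+1 <= delta n / 2) -> delta 0 <= c / 2 ->
  \sum_(n < N) delta n <= c.
Proof.
move=> d0 dS dc.
suff H : \sum_(n < N) delta n + 2 * delta N <= c by have := d0 N; lra.
elim: N => [|n IH]; first by rewrite big_ord0; lra.
by rewrite big_ord_recr/=; have := dS n; lra.
Qed.

Context (p : R) (p2 : 2 <= p).

Definition chaining_const : R := 2 * link_const p ^+ 2 + 4 * p * 4 `^ p.

(** [Np] stands for the [p]-th power of the norm. The bound [r] on the empirical sums stays a
    parameter because it will later depend on the sample. [H] does not depend on [f], so it can be
    averaged over the signs. *)
Lemma chaining_bound (T : Type) (m Q : nat) (x : 'I_m -> T) (L : set (T -> R))
    (Np : (T -> R) -> R) (D E r : R) :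
  0 < D -> 4 <= E -> (0 < m)%N -> (0 < Q)%N -> E * m%:R <= 2 ^+ Q ->
  (forall g h, L g -> L h -> L (midpoint g h)) ->
  (forall f, L f -> 0 <= Np f) ->
  (forall f t, L f -> `|f t| `^ p <= D * Np f) ->
  (forall g h t, L g -> L h ->
    Np (midpoint g h) + (`|g t - h t| / 2) `^ p / D <= (Np g + Np h) / 2) ->
  (forall f, L f -> Np f <= 1 -> \sum_(j < m) `|f (x j)| `^ p <= r) ->
  exists H : {ffun 'I_m -> bool} -> R,
    \sum_s H s <= 2 ^+ m * (chaining_const / E * r + D +
      D * E `^ (p - 1) * Q%:R * (2 * 2 `^ p * ln (4 * (Q * m)%:R) + 4)) /\
    forall s f, L f -> Np f <= 1 ->
      `|signed_sum s (fun j => `|f (x j)| `^ p)| <= H s.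
Proof.
move=> D0 E4 m0 Q0 Em Lmid Np0 Linf Npmid rP.
have p2' := p2.
have p0 : 0 < p by lra.
have E0 : 0 < E by lra.
pose K := D `^ p^-1.
have K0 : 0 < K by rewrite powR_gt0.
have Kp : K `^ p = D by rewrite -powRrM mulVf ?gt_eqF// powRr1 ?ltW.
pose u n : R := K / 2 ^+ n.+1.
pose delta n : R := (u n / 2) `^ p / D.
have u0 n : 0 < u n by rewrite divr_gt0 ?exprn_gt0.
have uS n : u n.+1 = u n / 2.
  by rewrite /u (exprS _ n.+1); field; rewrite expf_neq0// pnatr_eq0.
have d0 n : 0 < delta n by rewrite divr_gt0 ?powR_gt0 ?divr_gt0.
have upS n : u n.+1 `^ p <= u n `^ p / 2 by rewrite uS (halving_powR p2) ?ltW.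
have dS n : delta n.+1 <= delta n / 2.
  rewrite /delta -mulrA [D^-1 / 2]mulrC mulrA ler_pM2r ?invr_gt0//.
  by rewrite uS (halving_powR p2)// ltW ?divr_gt0.
have up n : u n `^ p = 2 `^ p * D * delta n.
  rewrite /delta powRM ?invr_ge0 ?(ltW (u0 n))//.
  rewrite -powR_inv1// -powRrM mulrC mulN1r powRN; field.
  by rewrite gt_eqF ?powR_gt0// gt_eqF.
pose appr := @approximant R T Q m x L Np u delta.
(* [psi] must be a function of the word alone; the filter recovers the code that produced the
   previous approximant, and the chain starts from [0]. *)
pose psi (k : nat) (w : seq (query Q m)) (j : 'I_m) :=
  link p E (u k) (appr k w (x j))
    (if k is k'.+1 then appr k' [seq i : query Q m <- w | (i.1.1 < k)%N] (x j) else 0).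
(* Each scale contributes a variance term [O(lam E^(p-2) r)]; this value makes the sum over the [Q]
   scales [O(r / E)]. *)
pose lam := (E `^ (p - 1) * Q%:R)^-1.
have lam0 : 0 < lam by rewrite invr_gt0 mulr_gt0 ?powR_gt0 ?ltr0n.
have lamV : 0 <= lam^-1 by rewrite invr_ge0 (ltW lam0).
(* All weights are at least [delta Q] and their total is at most [Np f <= 1], so no code is longer
   than [1 / delta Q]. *)
pose l := (Num.truncn (delta Q)^-1).+1.
have A0 : (0 < #|{: query Q m}|)%N by rewrite !card_prod !card_ord card_bool !muln_gt0 Q0 m0.
have lamk k : 0 <= lam / u k `^ p by rewrite divr_ge0 ?powR_ge0 ?ltW.
have [G GP] := choice (fun k : 'I_Q => signed_union_bound (psi k) l A0 (lamk k)).
pose al := ln (2 * #|{: query Q m}|%:R) : R.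
have alE : al = ln (4 * (Q * m)%:R).
  rewrite /al !card_prod !card_ord card_bool; congr ln.
  by rewrite !natrM; ring.
pose base := 2 * link_const p ^+ 2 / E * r + 2 * 2 `^ p * D * al / lam +
  4 * p * 4 `^ p / E * r + D.
exists (fun s => base + \sum_(k < Q) G k s * (u k `^ p / lam)); split.
  rewrite big_split/= sumr_const card_ffun card_ord card_bool exchange_big/=.
  under [X in _ + X <= _]eq_bigr do rewrite -mulr_suml.
  have h1 : \sum_(k < Q) (\sum_s G k s) * (u k `^ p / lam) <= 4 * 2 ^+ m * (D / lam).
    apply: (@le_trans _ _ (\sum_(k < Q) 4 * 2 ^+ m * (u k `^ p / lam))).
      apply: ler_sum => k _; apply: ler_wpM2r; first by rewrite divr_ge0 ?powR_ge0 ?ltW.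
      by case: (GP k).
    rewrite -mulr_sumr -mulr_suml ler_wpM2l ?mulr_ge0 ?exprn_ge0//.
    apply: ler_wpM2r => //.
    apply: (@geometric_sum_le (fun n => u n `^ p)) => //.
      by move=> n; exact: powR_ge0.
    by rewrite /u expr1 -Kp (halving_powR p2) ?ltW.
  have -> : base *+ (2 ^ m) = 2 ^+ m * base by rewrite -[LHS]mulr_natl natrX.
  apply: (le_trans (lerD (lexx _) h1)).
  rewrite le_eqVlt; apply/orP; left; apply/eqP.
  rewrite /base -alE /chaining_const /lam; field.
  by rewrite !gt_eqF ?powR_gt0 ?ltr0n.
move=> s f Lf Nf1.
have dQ n : (n <= Q)%N -> delta Q <= delta n.
  move=> nQ; rewrite -(subnK nQ); elim: (Q - n)%N => [//|i IH].
  by rewrite addSn (le_trans (dS _))//; have := d0 (i + n)%N; lra.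
have Npmid' n g h t : L g -> L h -> u n <= `|g t - h t| ->
    Np (midpoint g h) + delta n <= (Np g + Np h) / 2.
  move=> Lg Lh ule; apply: le_trans (Npmid g h t Lg Lh); rewrite lerD2l.
  apply: ler_wpM2r; first by rewrite invr_ge0 ltW.
  apply: ge0_ler_powR; rewrite ?nnegrE.
  - exact: ltW.
  - by rewrite ltW// divr_gt0.
  - by rewrite divr_ge0.
  - by apply: ler_wpM2r; rewrite ?invr_ge0.
have [W [kk [W0 Wf Wk Wu Wsum]]] := version_space_chain Q x Lmid Np0 d0 Npmid' Lf.
have sizeW n : (n < Q)%N -> (size (W n.+1) < l)%N.
  move=> nQ.
  have sle N : (N <= Q)%N -> (size (W N))%:R * delta Q <= \sum_(i < N) (kk i)%:R * delta i.
    elim: N => [|N IH] NQ; first by rewrite W0 mul0r big_ord0.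
    rewrite big_ord_recr/= Wk// natrD mulrDl lerD ?IH ?(ltnW NQ)//.
    by rewrite ler_wpM2l ?dQ// ltnW.
  have sub : \sum_(i < n.+1) (kk i)%:R * delta i <= \sum_(i < Q) (kk i)%:R * delta i.
    rewrite (big_ord_widen Q (fun i => (kk i)%:R * delta i) nQ) big_mkcond/=.
    by apply: ler_sum => i _; case: ifP => // _; rewrite mulr_ge0// ltW.
  rewrite ltnS /l truncn_ge_nat ?invr_ge0 ?(ltW (d0 Q))//.
  rewrite -[X in _ <= X]mul1r ler_pdivlMr//.
  by apply: le_trans (sle _ nQ) _; lra.
pose z (j : 'I_m) (k : nat) : R := if k is k'.+1 then appr k' (W k) (x j) else 0.
have psiE (k : 'I_Q) j : psi k (W k.+1) j = link p E (u k) (z j k.+1) (z j k).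
  rewrite /psi /z; congr (link _ _ _ _ _).
  by case: k => [[//|k] kQ] /=; rewrite -Wf.
have fK j : `|f (x j)| <= K.
  have h : `|f (x j)| `^ p <= D.
    by apply: (le_trans (Linf _ _ Lf)); rewrite -[leRHS]mulr1 ler_pM2l.
  rewrite -[`|f (x j)|]powRr1// -(mulfV (lt0r_neq0 p0)).
  rewrite powRrM /K; apply: ge0_ler_powR;
    by rewrite ?nnegrE ?invr_ge0 ?powR_ge0 ?(ltW p0) ?(ltW D0).
have close j k : (k < Q)%N -> `|f (x j) - z j k.+1| <= K / 2 ^+ k.+1.
  by move=> kQ; exact: Wu.
have close' j k : (k < Q)%N -> `|f (x j) - z j k| <= 2 * u k.
  case: k => [_|k kQ]; first by rewrite subr0 /u expr1 mulrC divfK.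
  by rewrite uS mulrC divfK//; apply: close; exact: ltnW.
have approx j := chaining_approx p2 (z := z j) E4 K0 erefl (fK j) (close j).
have fr := rP f Lf Nf1.
have linksum (k : 'I_Q) : `|signed_sum s (psi k (W k.+1))| <=
    2 * lam * link_const p ^+ 2 * E `^ (p - 2) * r +
    (size (W k.+1))%:R * (2 `^ p * D * delta k) * al / lam + G k s * (u k `^ p / lam).
  have [_ _ /(_ s (W k.+1) (sizeW _ (ltn_ord k)))] := GP k.
  set S := `|_|; rewrite -/al => h.
  have v0 : 0 < u k `^ p by rewrite powR_gt0.
  have sig : \sum_(j < m) psi k (W k.+1) j ^+ 2 <=
      link_const p ^+ 2 * E `^ (p - 2) * u k `^ p * r.
    apply: (@le_trans _ _ (\sum_(j < m) link_const p ^+ 2 * E `^ (p - 2) * u k `^ p *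
       `|f (x j)| `^ p)).
      apply: ler_sum => j _; rewrite psiE; apply: link_sqr_le => //.
        exact: close.
      exact: close'.
    by rewrite -mulr_sumr ler_wpM2l// !mulr_ge0 ?link_const_ge0 ?powR_ge0.
  have c0 : 0 <= 2 * (lam / u k `^ p) ^+ 2 by rewrite mulr_ge0 ?sqr_ge0.
  have {}h := le_trans h (lerD (lerD (ler_wpM2l c0 sig) (lexx _)) (lexx _)).
  rewrite -up.
  have -> : S = (u k `^ p / lam) * (lam / u k `^ p * S).
    by field; rewrite !gt_eqF.
  have c1 : 0 <= u k `^ p / lam by rewrite divr_ge0 ?ltW.
  apply: (le_trans (ler_wpM2l c1 h)).
  rewrite le_eqVlt; apply/orP; left; apply/eqP; field.
  by rewrite !gt_eqF.
have total : \sum_(k < Q) `|signed_sum s (psi k (W k.+1))| <=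
    2 * link_const p ^+ 2 / E * r + 2 * 2 `^ p * D * al / lam +
    \sum_(k < Q) G k s * (u k `^ p / lam).
  apply: (le_trans (ler_sum _ (fun k _ => linksum k))).
  rewrite !big_split/= lerD2r lerD//.
    rewrite sumr_const card_ord -[leLHS]mulr_natl /lam.
    have -> : E `^ (p - 1) = E * E `^ (p - 2).
      by rewrite -{2}(powRr1 (ltW E0)) -powRD ?(gt_eqF E0) ?implybT//; congr (_ `^ _); ring.
    rewrite le_eqVlt; apply/orP; left; apply/eqP; field.
    by rewrite !gt_eqF ?powR_gt0 ?ltr0n.
  have al0 : 0 <= al.
    rewrite alE ln_ge0// -natrM ler1n muln_gt0 muln_gt0/= Q0 m0//.
  have := sum_partial_sums_le (fun n => ltW (d0 n)) dS (S := fun n => size (W n)) (k := kk)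
    (N := Q) (congr1 size W0) Wk.
  move=> hh.
  have hle : \sum_(n < Q) (size (W n.+1))%:R * delta n <= 2.
    by apply: (le_trans hh); lra.
  have -> : \sum_(i < Q) (size (W i.+1))%:R * (2 `^ p * D * delta i) * al / lam =
      (2 `^ p * D * al / lam) * \sum_(n < Q) (size (W n.+1))%:R * delta n.
    by rewrite mulr_sumr; apply: eq_bigr => i _; ring.
  have -> : 2 * 2 `^ p * D * al / lam = (2 `^ p * D * al / lam) * 2 by ring.
  apply: ler_wpM2l => //; apply: mulr_ge0 => //; apply: mulr_ge0 => //.
  by rewrite mulr_ge0 ?powR_ge0 ?ltW.
have err : `|signed_sum s (fun j => `|f (x j)| `^ p) -
    \sum_(k < Q) signed_sum s (psi k (W k.+1))| <= 4 * p * 4 `^ p / E * r + D.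
  rewrite /signed_sum exchange_big/= -sumrB.
  under eq_bigr do rewrite -mulr_sumr -mulrBr.
  apply: (le_trans (ler_norm_sum _ _ _)).
  apply: (@le_trans _ _ (\sum_(j < m) (4 * p * 4 `^ p / E * `|f (x j)| `^ p +
      (E * (K / 2 ^+ Q.+1)) `^ p))).
    apply: ler_sum => j _; rewrite normrM normrX normrN1 expr1n mul1r.
    under eq_bigr do rewrite psiE.
    exact: approx.
  rewrite big_split/= -mulr_sumr; apply: lerD.
    by rewrite ler_wpM2l// !mulr_ge0 ?invr_ge0 ?powR_ge0 ?(ltW E0) ?(ltW p0).
  rewrite sumr_const card_ord -[leLHS]mulr_natl.
  have mR : 0 < m%:R :> R by rewrite ltr0n.
  (* The finest scale leaves at most [(K / m)^p = D / m^p] at each of the [m] points, hence at most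
     [D] altogether. *)
  have small : E * (K / 2 ^+ Q.+1) <= K * m%:R^-1.
    have -> : E * (K / 2 ^+ Q.+1) = K * (E / 2 ^+ Q.+1) by ring.
    rewrite ler_pM2l// ler_pdivrMr ?exprn_gt0// ler_pdivlMl// exprS.
    have : 0 < 2 ^+ Q :> R by rewrite exprn_gt0.
    lra.
  have : (E * (K / 2 ^+ Q.+1)) `^ p <= (K * m%:R^-1) `^ p.
    by rewrite ge0_ler_powR ?nnegrE ?mulr_ge0 ?invr_ge0 ?exprn_ge0 ?(ltW p0) ?(ltW K0) ?(ltW E0).
  rewrite [leRHS]powRM ?invr_ge0 ?(ltW K0)// Kp => h.
  have h2 : (m%:R^-1 : R) `^ p <= m%:R^-1.
    apply: ge1r_powR; last by lra.
    by rewrite invr_gt0 mR invf_le1// ler1n.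
  have h3 := ler_wpM2l (ltW D0) h2.
  have h4 := ler_wpM2l (ltW mR) (le_trans h h3).
  apply: (le_trans h4); rewrite mulrCA divff ?mulr1// gt_eqF//.
have := ler_normD (signed_sum s (fun j => `|f (x j)| `^ p) -
    \sum_(k < Q) signed_sum s (psi k (W k.+1))) (\sum_(k < Q) signed_sum s (psi k (W k.+1))).
rewrite subrK => tri; apply: (le_trans tri).
have := ler_norm_sum (index_enum 'I_Q) (fun k : 'I_Q => signed_sum s (psi k (W k.+1))) xpredT.
move=> tri2.
have := le_trans tri2 total.
rewrite /base; lra.
Qed.

End chaining.

(** * Symmetrization over a finite probability space *)

Section real_suprema.
Context {R : realType} {I : Type} (B : set I) (g : I -> R).

Lemma sup_image_ge (b : R) : (forall i, B i -> g i <= b) ->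
  forall i, B i -> g i <= sup [set g i | i in B].
Proof.
move=> gb i Bi; apply: ub_le_sup; last by exists i.
by exists b => _ [k Bk <-]; exact: gb.
Qed.

Lemma sup_image_le (b : R) : B !=set0 -> (forall i, B i -> g i <= b) ->
  sup [set g i | i in B] <= b.
Proof.
move=> [i Bi] gb; apply: ge_sup; first by exists (g i), i.
by move=> _ [k Bk <-]; exact: gb.
Qed.

End real_suprema.

Section finite_symmetrization.
Context {R : realType} (C : finType) (q : C -> R) (m : nat).
Hypothesis q_ge0 : forall c, 0 <= q c.
Hypothesis q_sum : \sum_c q c = 1.
Local Notation samples := {ffun 'I_m -> C}.
Local Notation signs := {ffun 'I_m -> bool}.

Definition sample_weight (c : samples) : R := \prod_(j < m) q (c j).

Lemma sample_weight_ge0 c : 0 <= sample_weight c.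
Proof. exact: prodr_ge0. Qed.

Lemma sum_sample_weight : \sum_c sample_weight c = 1.
Proof.
rewrite /sample_weight -(bigA_distr_bigA (fun (j : 'I_m) c => q c))/=.
by under eq_bigr do rewrite q_sum; rewrite big1.
Qed.

Lemma sum_sample_weight_coord (g : C -> R) (j : 'I_m) :
  \sum_c sample_weight c * g (c j) = \sum_c q c * g c.
Proof.
rewrite (eq_bigr (fun c : samples => \prod_(i < m) (q (c i) * if i == j then g (c i) else 1))).
  rewrite -(bigA_distr_bigA (fun (i : 'I_m) c => q c * if i == j then g c else 1))/=.
  rewrite (bigD1 j)//= eqxx [X in _ * X]big1 ?mulr1// => i /negbTE ij.
  by under eq_bigr do rewrite ij mulr1.
move=> c _; rewrite big_split/=; congr (_ * _).
by rewrite (bigD1 j)//= eqxx big1 ?mulr1// => i /negbTE ->.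
Qed.

Definition swap (s : signs) (c c' : samples) : samples :=
  [ffun j => if s j then c' j else c j].

Lemma swapK s c c' : swap s (swap s c c') (swap s c' c) = c.
Proof. by apply/ffunP => j; rewrite !ffunE; case: (s j). Qed.

Lemma sum_swap s (V : samples -> samples -> R) :
  \sum_c \sum_c' sample_weight c * sample_weight c' * V c c' =
  \sum_c \sum_c' sample_weight c * sample_weight c' * V (swap s c c') (swap s c' c).
Proof.
rewrite !pair_big/=.
pose h (cc : samples * samples) := (swap s cc.1 cc.2, swap s cc.2 cc.1).
have hK : involutive h by case=> c c'; rewrite /h/= !swapK.
rewrite (reindex_inj (inv_inj hK))/=; apply: eq_bigr => -[c c'] _ /=.
congr (_ * _); rewrite /sample_weight -!big_split/=; apply: eq_bigr => j _.
by rewrite !ffunE; case: (s j); rewrite // mulrC.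
Qed.

Context (I : Type) (B : set I) (phi : I -> C -> R) (b : R).
Hypothesis m_gt0 : (0 < m)%N.
Hypothesis B_nonempty : B !=set0.
Hypothesis phi_bound : forall i c, B i -> 0 <= phi i c <= b.

Definition deviation (c : samples) (i : I) : R :=
  `|m%:R^-1 * \sum_(j < m) phi i (c j) - \sum_c q c * phi i c|.

Definition sup_deviation (c : samples) : R := sup [set deviation c i | i in B].

Let mR : 0 < m%:R :> R. Proof. by rewrite ltr0n. Qed.

Lemma empirical_bound c i : B i -> 0 <= m%:R^-1 * \sum_(j < m) phi i (c j) <= b.
Proof.
move=> Bi; apply/andP; split.
  rewrite mulr_ge0 ?invr_ge0 ?(ltW mR)// sumr_ge0// => j _.
  by case/andP: (phi_bound (c j) Bi).
rewrite ler_pdivrMl//; apply: (@le_trans _ _ (\sum_(j < m) b)).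
  by apply: ler_sum => j _; case/andP: (phi_bound (c j) Bi).
by rewrite sumr_const card_ord mulr_natl.
Qed.

Lemma mean_bound i : B i -> 0 <= \sum_c q c * phi i c <= b.
Proof.
move=> Bi; apply/andP; split.
  apply: sumr_ge0 => c _; rewrite mulr_ge0//.
  by case/andP: (phi_bound c Bi).
rewrite -[b]mul1r -q_sum mulr_suml; apply: ler_sum => c _.
by rewrite ler_wpM2l//; case/andP: (phi_bound c Bi).
Qed.

Lemma deviation_le_sup c i : B i -> deviation c i <= sup_deviation c.
Proof.
apply: (@sup_image_ge _ _ B (deviation c) b) => k Bk.
rewrite /deviation ler_norml.
by case/andP: (empirical_bound c Bk); case/andP: (mean_bound Bk) => *; apply/andP; split; lra.
Qed.

Lemma sup_deviation_ge0 c : 0 <= sup_deviation c.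
Proof.
by have [i Bi] := B_nonempty; apply: le_trans (deviation_le_sup c Bi); exact: normr_ge0.
Qed.

(** The true mean is the average of the empirical mean over an independent copy [c']. Exchanging
    [c j] and [c' j] where [s j] holds preserves the joint weight and puts the sign of [s j] on the
    [j]-th difference. The two samples account for the factor 2. The estimate holds for each fixed
    [s] and is averaged at the end. *)
Lemma symmetrization (H : samples -> signs -> R) :
  (forall (c : samples) (s : signs) i, B i -> `|signed_sum s (fun j => phi i (c j))| <= H c s) ->
  \sum_c sample_weight c * sup_deviation c <=
  2 / m%:R * \sum_c sample_weight c * (2 ^- m * \sum_s H c s).
Proof.
move=> HP.
pose dd (c c' : samples) i := `|m%:R^-1 * \sum_(j < m) (phi i (c j) - phi i (c' j))|.
pose V (c c' : samples) := sup [set dd c c' i | i in B].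
have ddE c c' i : dd c c' i =
    `|m%:R^-1 * \sum_(j < m) phi i (c j) - m%:R^-1 * \sum_(j < m) phi i (c' j)|.
  by rewrite /dd sumrB mulrBr.
have ddV c c' i : B i -> dd c c' i <= V c c'.
  apply: (@sup_image_ge _ _ B (dd c c') b) => k Bk; rewrite ddE ler_norml.
  by case/andP: (empirical_bound c Bk); case/andP: (empirical_bound c' Bk) => *;
    apply/andP; split; lra.
have ghost c : sup_deviation c <= \sum_c' sample_weight c' * V c c'.
  apply: sup_image_le => // i Bi; rewrite /deviation.
  have -> : m%:R^-1 * \sum_(j < m) phi i (c j) - \sum_c q c * phi i c =
      \sum_c' sample_weight c' * (m%:R^-1 * \sum_(j < m) (phi i (c j) - phi i (c' j))).
    under [RHS]eq_bigr do rewrite sumrB mulrBr mulrBr.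
    rewrite sumrB -mulr_suml sum_sample_weight mul1r; congr (_ - _).
    rewrite (eq_bigr (fun c' : samples => m%:R^-1 * \sum_(j < m) sample_weight c' * phi i (c' j))).
      rewrite -mulr_sumr exchange_big/=.
      under [in RHS]eq_bigr do rewrite (sum_sample_weight_coord (phi i)).
      by rewrite sumr_const card_ord -[X in _ * X]mulr_natl mulrA mulVf ?mul1r// gt_eqF.
    by move=> c' _; rewrite mulrCA mulr_sumr.
  apply: (le_trans (ler_norm_sum _ _ _)); apply: ler_sum => c' _.
  rewrite normrM ger0_norm ?sample_weight_ge0//.
  by rewrite ler_wpM2l ?sample_weight_ge0//; exact: ddV.
have swapV s c c' : V (swap s c c') (swap s c' c) <= m%:R^-1 * (H c s + H c' s).
  apply: sup_image_le => // i Bi; rewrite /dd normrM ger0_norm ?invr_ge0 ?(ltW mR)//.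
  rewrite ler_wpM2l ?invr_ge0 ?(ltW mR)//.
  have -> : \sum_(j < m) (phi i (swap s c c' j) - phi i (swap s c' c j)) =
      signed_sum s (fun j => phi i (c j)) - signed_sum s (fun j => phi i (c' j)).
    rewrite /signed_sum -sumrB; apply: eq_bigr => j _; rewrite !ffunE.
    by case: (s j); rewrite ?expr1 ?expr0; ring.
  by apply: (le_trans (ler_normB _ _)); rewrite lerD ?HP.
have bound s : \sum_c sample_weight c * sup_deviation c <=
    2 / m%:R * \sum_c sample_weight c * H c s.
  apply: (@le_trans _ _ (\sum_c \sum_c' sample_weight c * sample_weight c' * V c c')).
    apply: ler_sum => c _; under [leRHS]eq_bigr do rewrite -mulrA.
    by rewrite -mulr_sumr ler_wpM2l ?sample_weight_ge0.
  rewrite (sum_swap s).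
  apply: (@le_trans _ _ (\sum_c \sum_c' sample_weight c * sample_weight c' *
      (m%:R^-1 * (H c s + H c' s)))).
    apply: ler_sum => c _; apply: ler_sum => c' _.
    by rewrite ler_wpM2l ?mulr_ge0 ?sample_weight_ge0.
  pose w := sample_weight.
  have e1 : \sum_c \sum_c' w c * w c' * (m%:R^-1 * H c s) = m%:R^-1 * \sum_c w c * H c s.
    rewrite mulr_sumr; apply: eq_bigr => c _.
    rewrite -mulr_suml -mulr_sumr sum_sample_weight mulr1; ring.
  have e2 : \sum_c \sum_c' w c * w c' * (m%:R^-1 * H c' s) = m%:R^-1 * \sum_c w c * H c s.
    rewrite exchange_big/= -e1; apply: eq_bigr => c _; apply: eq_bigr => c' _.
    by rewrite (mulrC (w c)).
  under eq_bigr do (under eq_bigr do rewrite mulrDr mulrDr; rewrite big_split/=).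
  by rewrite big_split/= e1 e2; lra.
have two0 : 0 < 2 ^+ m :> R by rewrite exprn_gt0.
rewrite -(ler_pM2l two0).
have -> : 2 ^+ m * (2 / m%:R * \sum_c sample_weight c * (2 ^- m * \sum_s H c s)) =
    \sum_s 2 / m%:R * \sum_c sample_weight c * H c s.
  rewrite -mulr_sumr exchange_big/= mulrCA; congr (_ * _).
  rewrite mulr_sumr; apply: eq_bigr => c _; rewrite -mulr_sumr.
  by rewrite mulrCA mulrA mulrA -(mulrA (sample_weight c)) mulfV ?gt_eqF// mulr1.
have -> : 2 ^+ m * \sum_c sample_weight c * sup_deviation c =
    \sum_(s : signs) \sum_c sample_weight c * sup_deviation c.
  by rewrite sumr_const card_ffun card_ord card_bool -[RHS]mulr_natl natrX.
by apply: ler_sum => s _; exact: bound.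
Qed.

End finite_symmetrization.

(** * The expected deviation over a finite probability space *)

Section finite_sampling.
Context {R : realType}.

Lemma ln2_gt0 : 0 < ln 2 :> R. Proof. by rewrite ln_gt0// ltr1n. Qed.

Lemma ln_nat_ge2 (m : nat) : (2 <= m)%N -> ln 2 <= ln m%:R :> R.
Proof. by move=> m2; rewrite ler_ln ?posrE ?ltr0n ?ler_nat// (ltn_trans _ m2). Qed.

(* [Q] dyadic scales resolve every value above [1/m], for [E] up to [2^e0 m]. *)
Lemma number_of_scales (p : R) (e0 : nat) : exists2 C0 : R, 0 <= C0 &
  forall m, (2 <= m)%N -> exists Q : nat, [/\ (0 < Q)%N,
    2 ^+ e0 * m%:R * m%:R <= 2 ^+ Q :> R &
    1 + Q%:R * (2 * 2 `^ p * ln (4 * (Q * m)%:R) + 4) <= C0 * ln m%:R ^+ 2].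
Proof.
have l0 := ln2_gt0.
pose l2 : R := ln 2.
pose c1 : R := (e0%:R + 4) / l2.
have c10 : 0 < c1 by rewrite divr_gt0.
have P0 : 0 <= 2 `^ p :> R by exact: powR_ge0.
exists (c1 * (2 * 2 `^ p * (3 + c1) + 4 / l2) + (l2 ^+ 2)^-1).
  rewrite addr_ge0 ?invr_ge0 ?sqr_ge0// mulr_ge0 ?(ltW c10)//.
  rewrite addr_ge0 ?divr_ge0 ?(ltW l0)// mulr_ge0 ?mulr_ge0//; lra.
move=> m m2.
have m0 : (0 < m)%N by rewrite (ltn_trans _ m2).
have mR : 0 < m%:R :> R by rewrite ltr0n.
pose l := up_log 2 m.
have lge : (m <= 2 ^ l)%N by rewrite up_logP.
have l1 : (0 < l)%N by rewrite up_log_gt0.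
have llt : (2 ^ l.-1 < m)%N by rewrite up_log_gtn.
(* [2 ^ l >= m], and two such factors give [m^2]. *)
pose Q := (e0 + 2 * l)%N.
have Q0 : (0 < Q)%N by rewrite addn_gt0 muln_gt0 l1 orbT.
set Lm : R := ln m%:R.
have Lm2 : l2 <= Lm by exact: ln_nat_ge2.
have Lm0 : 0 < Lm by exact: lt_le_trans Lm2.
have lle : l%:R * l2 <= 2 * Lm.
  have : (2 ^ l.-1)%:R <= m%:R :> R by rewrite ler_nat ltnW.
  rewrite natrX -ler_ln ?posrE ?exprn_gt0// lnXn// -[_ *+ _]mulr_natl -/l2 -/Lm.
  by rewrite -{2}(prednK l1) -natr1 mulrDl mul1r; lra.
have QR : Q%:R <= c1 * Lm.
  rewrite -(ler_pM2r l0) -/l2.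
  have -> : c1 * Lm * l2 = (e0%:R + 4) * Lm by rewrite /c1; field; rewrite gt_eqF.
  rewrite /Q natrD natrM mulrDl.
  have : e0%:R * l2 <= e0%:R * Lm by rewrite ler_wpM2l.
  lra.
exists Q; split=> //.
  have h : m%:R <= 2 ^+ l :> R by rewrite -natrX ler_nat.
  rewrite /Q exprD mulnC exprM -mulrA ler_wpM2l ?exprn_ge0//.
  by rewrite expr2 ler_pM.
have QR0 : 0 < Q%:R :> R by rewrite ltr0n.
(* The crude bound [ln Q <= Q] suffices, because [Q] is already [O(ln m)]. *)
have lnbound : ln (4 * (Q * m)%:R) <= (3 + c1) * Lm.
  have -> : (4 : R) = 2 * 2 by ring.
  rewrite natrM !lnM ?posrE ?mulr_gt0// -/l2 -/Lm.
  have := ln_sublinear QR0; lra.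
have LL : 1 <= (l2 ^+ 2)^-1 * Lm ^+ 2.
  rewrite mulrC ler_pdivlMr ?exprn_gt0// mul1r.
  by rewrite ler_sqr ?nnegrE ?(ltW l0) ?(ltW Lm0).
have four : 4 <= 4 / l2 * Lm.
  by rewrite mulrAC ler_pdivlMr// ler_wpM2l.
set P : R := 2 `^ p in P0 *.
have inner : 2 * P * ln (4 * (Q * m)%:R) + 4 <= (2 * P * (3 + c1) + 4 / l2) * Lm.
  have : 2 * P * ln (4 * (Q * m)%:R) <= 2 * P * ((3 + c1) * Lm).
    by rewrite ler_wpM2l// mulr_ge0.
  by rewrite mulrDl mulrA; lra.
have lnn : 0 <= ln (4 * (Q * m)%:R) :> R.
  rewrite ln_ge0// -natrM ler1n !muln_gt0 Q0 m0//.
have outer : Q%:R * (2 * P * ln (4 * (Q * m)%:R) + 4) <=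
    c1 * Lm * ((2 * P * (3 + c1) + 4 / l2) * Lm).
  by apply: ler_pM => //; rewrite addr_ge0// !mulr_ge0.
apply: (le_trans (lerD LL outer)); rewrite le_eqVlt; apply/orP; left; apply/eqP.
ring.
Qed.

Context (p : R) (p2 : 2 <= p).

Let p1 : 1 < p. Proof. by rewrite (lt_le_trans _ p2)// ltr1n. Qed.
Let p0 : 0 < p. Proof. by rewrite (lt_trans _ p1). Qed.

(** No root is taken: Clarkson's inequality is additive in the [p]-th power. *)
Definition pmean (C : finType) (T : Type) (q : C -> R) (y : C -> T) (f : T -> R) : R :=
  \sum_c q c * `|f (y c)| `^ p.

Lemma chaining_const_ge0 : 0 <= chaining_const p.
Proof.
by rewrite /chaining_const addr_ge0 ?mulr_ge0 ?link_const_ge0 ?powR_ge0 ?(ltW p0).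
Qed.

Section fixed_space.
Context (C : finType) (T : Type) (q : C -> R) (y : C -> T) (L : set (T -> R)) (D : R).
Hypothesis q_ge0 : forall c, 0 <= q c.
Hypothesis q_sum : \sum_c q c = 1.
Hypothesis D_ge1 : 1 <= D.
Hypothesis L_nonempty : L !=set0.
Hypothesis L_comb : forall a b f g, L f -> L g -> L (fun t => a * f t + b * g t).
Hypothesis L_bound : forall f t, L f -> `|f t| `^ p <= D * pmean q y f.

Let B := [set f | L f /\ pmean q y f <= 1].
Let phi (f : T -> R) (c : C) := `|f (y c)| `^ p.

Lemma pmean_ge0 f : 0 <= pmean q y f.
Proof. by apply: sumr_ge0 => c _; rewrite mulr_ge0 ?powR_ge0. Qed.

Lemma pmean_clarkson g h : pmean q y (midpoint g h) +
  pmean q y (fun t => 2^-1 * g t + - 2^-1 * h t) <= (pmean q y g + pmean q y h) / 2.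
Proof.
rewrite /pmean -!big_split/= mulr_suml; apply: ler_sum => c _.
rewrite -!mulrDr -mulrA ler_wpM2l//.
apply: le_trans (powR_clarkson _ _ p2).
by rewrite (_ : 2^-1 * g (y c) + - 2^-1 * h (y c) = (g (y c) - h (y c)) / 2); last ring.
Qed.

(** On the unit ball the empirical sum is at most [m (1 + sup_deviation)]. With this as [r] in
    [chaining_bound], the expected deviation [Z] reappears on the right, multiplied by [1 / E]. *)
Lemma sampling_recursion (m Q : nat) (E Z : R) : (0 < m)%N -> (0 < Q)%N ->
  4 <= E -> E * m%:R <= 2 ^+ Q ->
  Z = \sum_c sample_weight (m := m) q c * sup_deviation q B phi c ->
  Z <= 2 * chaining_const p / E * (1 + Z) + 2 * D / m%:R * E `^ (p - 1) *
     (1 + Q%:R * (2 * 2 `^ p * ln (4 * (Q * m)%:R) + 4)).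
Proof.
move=> m0 Q0 E4 Em ZE; rewrite [leLHS]ZE.
have mR : 0 < m%:R :> R by rewrite ltr0n.
have D0 : 0 < D by rewrite (lt_le_trans _ D_ge1).
have E0 : 0 < E by rewrite (lt_le_trans _ E4).
have Bne : B !=set0.
  have [f Lf] := L_nonempty; exists (fun t => 0 * f t + 0 * f t); split.
    exact: L_comb.
  rewrite /pmean big1// => c _.
  by rewrite !mul0r addr0 normr0 powR0 ?mulr0// gt_eqF.
have phiB f c : B f -> 0 <= phi f c <= D.
  move=> [Lf f1]; rewrite powR_ge0/=; apply: (le_trans (L_bound _ Lf)).
  by rewrite -[leRHS]mulr1 ler_pM2l.
have Lmid g h : L g -> L h -> L (midpoint g h).
  move=> Lg Lh; rewrite (_ : midpoint g h = fun t => 2^-1 * g t + 2^-1 * h t); first exact: L_comb.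
  by apply/funext => t; rewrite /midpoint -mulrDr mulrC.
have Npmid g h t : L g -> L h ->
    pmean q y (midpoint g h) + (`|g t - h t| / 2) `^ p / D <= (pmean q y g + pmean q y h) / 2.
  move=> Lg Lh; apply: le_trans (pmean_clarkson g h); rewrite lerD2l.
  rewrite ler_pdivrMr// [leRHS]mulrC; apply: le_trans (L_bound t (L_comb 2^-1 (- 2^-1) Lg Lh)).
  by rewrite mulNr -mulrBr normrM ger0_norm ?invr_ge0// mulrC.
pose r (c : {ffun 'I_m -> C}) : R := m%:R * (1 + sup_deviation q B phi c).
have rP (c : {ffun 'I_m -> C}) f : L f -> pmean q y f <= 1 ->
    \sum_(j < m) `|f (y (c j))| `^ p <= r c.
  move=> Lf f1; rewrite /r -ler_pdivrMl//.
  have := deviation_le_sup q_ge0 q_sum m0 phiB c (conj Lf f1 : B f).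
  by rewrite /deviation ler_norml -/(pmean q y f) => /andP[_]; rewrite /phi; lra.
have [H HP] := choice (fun c : {ffun 'I_m -> C} => chaining_bound p2 D0 E4 m0 Q0 Em
   Lmid (fun f _ => pmean_ge0 f) L_bound Npmid (rP c)).
have := symmetrization q_ge0 q_sum m0 Bne phiB
  (fun c s f Bf => (HP c).2 s f Bf.1 Bf.2).
move=> /le_trans; apply.
set A := 2 * 2 `^ p * _ + 4.
have step : \sum_c sample_weight (m := m) q c * (2 ^- m * \sum_s H c s) <=
    \sum_c sample_weight (m := m) q c *
      (chaining_const p / E * r c + D + D * E `^ (p - 1) * Q%:R * A).
  apply: ler_sum => c _; apply: ler_wpM2l; first exact: sample_weight_ge0.
  rewrite ler_pdivrMl ?exprn_gt0//; exact: (HP c).1.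
apply: (le_trans (ler_wpM2l _ step)); first by rewrite divr_ge0 ?ltW.
have -> : \sum_c sample_weight (m := m) q c *
      (chaining_const p / E * r c + D + D * E `^ (p - 1) * Q%:R * A) =
    chaining_const p / E * m%:R * (1 + Z) + (D + D * E `^ (p - 1) * Q%:R * A).
  under eq_bigr => c _.
    rewrite (_ : _ * _ = sample_weight q c * (chaining_const p / E * m%:R +
      (D + D * E `^ (p - 1) * Q%:R * A)) + chaining_const p / E * m%:R *
      (sample_weight q c * sup_deviation q B phi c)); last by rewrite /r; ring.
    over.
  by rewrite big_split/= -mulr_suml -mulr_sumr sum_sample_weight// -ZE; ring.
have E1 : 1 <= E `^ (p - 1).
  by rewrite -[leLHS](powRr0 E) ler_powR ?subr_ge0 ?(ltW p1)//; lra.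
have -> : 2 / m%:R * (chaining_const p / E * m%:R * (1 + Z) +
    (D + D * E `^ (p - 1) * Q%:R * A)) = 2 * chaining_const p / E * (1 + Z) +
    2 * D / m%:R * (1 + E `^ (p - 1) * Q%:R * A).
  by field; rewrite !gt_eqF.
rewrite lerD2l -(mulrA (2 * D / m%:R)); apply: ler_wpM2l.
  by rewrite divr_ge0 ?mulr_ge0 ?ltW.
by rewrite (mulrDr (E `^ (p - 1))) mulr1 mulrA lerD2r.
Qed.

(** Both sides scale like [|f|^p], so [f] may be normalized. If its mean vanishes this is
    impossible, but then [L_bound] forces [f] to vanish at all the points [y c]. *)
Lemma deviation_homogeneous (m : nat) (c : {ffun 'I_m -> C}) f : (0 < m)%N -> L f ->
  deviation q phi c f <= sup_deviation q B phi c * pmean q y f.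
Proof.
move=> m0 Lf; have mR : 0 < m%:R :> R by rewrite ltr0n.
have D0 : 0 < D by rewrite (lt_le_trans _ D_ge1).
have phiB g c' : B g -> 0 <= phi g c' <= D.
  move=> [Lg g1]; rewrite powR_ge0/=; apply: (le_trans (L_bound _ Lg)).
  by rewrite -[leRHS]mulr1 ler_pM2l.
have := pmean_ge0 f; rewrite le_eqVlt => /predU1P[Nf0|Nf0].
  have phi0 c' : phi f c' = 0.
    apply: le_anti; rewrite powR_ge0 andbT.
    by have := L_bound (y c') Lf; rewrite -Nf0 mulr0.
  rewrite -Nf0 mulr0 /deviation.
  by rewrite !big1 ?mulr0 ?subrr ?normr0// => k _; rewrite phi0 ?mulr0.
set n := pmean q y f in Nf0 *.
pose g t := n `^ (- p^-1) * f t + 0 * f t.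
have phig c' : phi g c' = n^-1 * phi f c'.
  rewrite /phi /g mul0r addr0 normrM powRM// ger0_norm ?powR_ge0//.
  by rewrite -powRrM mulNr mulVf ?gt_eqF// powR_inv1// ltW.
have ng : pmean q y g = 1.
  rewrite /pmean (eq_bigr (fun c' => n^-1 * (q c' * phi f c'))).
    by rewrite -mulr_sumr mulVf// gt_eqF.
  by move=> c' _; rewrite -/(phi g c') phig mulrCA.
have Bg : B g by split; [exact: L_comb|rewrite ng].
rewrite -ler_pdivrMr//.
have -> : deviation q phi c f / n = deviation q phi c g.
  have e1 : \sum_(j < m) phi g (c j) = n^-1 * \sum_(j < m) phi f (c j).
    by rewrite mulr_sumr; apply: eq_bigr => j _; rewrite phig.
  have e2 : \sum_c' q c' * phi g c' = n^-1 * \sum_c' q c' * phi f c'.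
    by rewrite mulr_sumr; apply: eq_bigr => c' _; rewrite phig mulrCA.
  rewrite /deviation e1 e2 mulrCA -mulrBr normrM [`|n^-1|]ger0_norm 1?mulrC//.
  by rewrite invr_ge0 ltW.
exact (deviation_le_sup q_ge0 q_sum m0 phiB c Bg).
Qed.

End fixed_space.

Lemma finite_sampling : exists2 Cp : R, 0 <= Cp &
  forall (C : finType) (T : Type) (q : C -> R) (y : C -> T) (L : set (T -> R)) (D : R),
  (forall c, 0 <= q c) -> \sum_c q c = 1 -> 1 <= D -> L !=set0 ->
  (forall a b f g, L f -> L g -> L (fun t => a * f t + b * g t)) ->
  (forall f t, L f -> `|f t| `^ p <= D * pmean q y f) ->
  forall m (t : R), (2 <= m)%N -> t = D * ln m%:R ^+ 2 / m%:R ->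
  \sum_c sample_weight (m := m) q c *
    sup_deviation q [set f | L f /\ pmean q y f <= 1] (fun f c => `|f (y c)| `^ p) c <=
  Cp * (t + t `^ p^-1).
Proof.
have C10 := chaining_const_ge0.
set C1 := chaining_const p in C10.
(* Makes [2 * C1 / E <= 1 / 2], so that half of [Z] can be absorbed. *)
pose E0 : R := 4 + 4 * C1.
pose l2 : R := ln 2.
have l20 : 0 < l2 := ln2_gt0.
(* Since [D >= 1], [1 / t <= m / (ln 2)^2]; this [e0] therefore ensures [E <= 2 ^ e0 * m], the range
   allowed by [number_of_scales]. *)
have [e0 e0P] : exists e0 : nat, E0 + (l2 ^+ 2)^-1 <= 2 ^+ e0.
  exists (up_log 2 (Num.truncn (E0 + (l2 ^+ 2)^-1)).+1).
  apply: (@le_trans _ _ (Num.truncn (E0 + (l2 ^+ 2)^-1)).+1%:R).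
    by rewrite ltW// truncnS_gt.
  by rewrite -natrX ler_nat up_logP.
have l2V : 0 < (l2 ^+ 2)^-1 by rewrite invr_gt0 exprn_gt0.
have E0ge : 4 <= E0 by rewrite /E0; lra.
have [C0 C00 scales] := number_of_scales p e0.
exists (4 * C1 + 4 * C0 + 4 * C0 * E0 `^ (p - 1)).
  by rewrite !addr_ge0 ?mulr_ge0 ?powR_ge0.
move=> C T q y L D q0 q1 D1 Lne Lcomb Lbound m t m2 tE0.
have m0 : (0 < m)%N by rewrite (ltn_trans _ m2).
have mR : 0 < m%:R :> R by rewrite ltr0n.
have m1 : 1 <= m%:R :> R by rewrite ler1n.
have D0 : 0 < D by rewrite (lt_le_trans _ D1).
have Lm : l2 <= ln m%:R := ln_nat_ge2 m2.
have lnm0 : 0 < ln m%:R :> R by exact: lt_le_trans Lm.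
have lm2 : l2 ^+ 2 <= ln m%:R ^+ 2 by rewrite ler_sqr ?nnegrE ?(ltW l20) ?(ltW lnm0).
have lm0 : 0 < ln m%:R ^+ 2 :> R by rewrite exprn_gt0.
have t0 : 0 < t by rewrite tE0 divr_gt0 ?mulr_gt0.
set s := t `^ p^-1.
have s0 : 0 < s by rewrite powR_gt0.
have sV : s^-1 <= 2 ^+ e0 * m%:R.
  have tV : t^-1 <= (l2 ^+ 2)^-1 * m%:R.
    rewrite tE0 invf_div mulrC ler_pM2r// lef_pV2 ?posrE ?mulr_gt0 ?exprn_gt0//.
    by apply: (le_trans lm2); rewrite ler_peMl// ltW.
  have X1 : 1 <= 2 ^+ e0 * m%:R :> R.
    by rewrite mulr_ege1// exprn_ege1// ler1n.
  have tX : t^-1 <= 2 ^+ e0 * m%:R.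
    by apply: (le_trans tV); rewrite ler_pM2r//; lra.
  have -> : s^-1 = (t^-1) `^ p^-1.
    by rewrite /s -powRN -[t^-1]powR_inv1 ?(ltW t0)// -powRrM mulN1r.
  apply: (@le_trans _ _ ((2 ^+ e0 * m%:R) `^ p^-1)).
    by rewrite ge0_ler_powR ?nnegrE ?invr_ge0 ?(ltW p0) ?(ltW t0)// (le_trans _ X1).
  by rewrite ler1_powR// invf_le1// ltW.
pose E := Num.max E0 s^-1.
have E4 : 4 <= E by rewrite le_max; apply/orP; left; rewrite /E0; lra.
have Epos : 0 < E by lra.
have Ele : E <= 2 ^+ e0 * m%:R.
  rewrite ge_max sV andbT; apply: (@le_trans _ _ (2 ^+ e0)); first by lra.
  by rewrite ler_peMr ?exprn_ge0.
have [Q [Q0 Qge Qle]] := scales m m2.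
have EQ : E * m%:R <= 2 ^+ Q by apply: le_trans Qge; rewrite ler_pM2r.
have := sampling_recursion q0 q1 D1 Lne Lcomb Lbound m0 Q0 E4 EQ erefl.
set Z := \sum_c _; rewrite -/C1 => rec.
have half : 2 * C1 / E <= 1 / 2.
  rewrite ler_pdivrMr//; have : E0 <= E by rewrite le_max lexx.
  rewrite /E0; lra.
have EV : E^-1 <= s.
  by rewrite -[s]invrK lef_pV2 ?posrE ?invr_gt0// le_max lexx orbT.
have tail : 2 * D / m%:R * E `^ (p - 1) *
    (1 + Q%:R * (2 * 2 `^ p * ln (4 * (Q * m)%:R) + 4)) <= 2 * C0 * (t * E `^ (p - 1)).
  have c0 : 0 <= 2 * D / m%:R * E `^ (p - 1).
    by rewrite mulr_ge0 ?powR_ge0// divr_ge0 ?mulr_ge0 ?ltW.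
  apply: (le_trans (ler_wpM2l c0 Qle)); rewrite tE0 le_eqVlt; apply/orP; left; apply/eqP.
  by field; rewrite gt_eqF.
(* With [E = 1 / s] and [t = s^p], the product is exactly [s]. *)
have tE : t * E `^ (p - 1) <= t * E0 `^ (p - 1) + s.
  have -> : s = t * (s^-1) `^ (p - 1).
    rewrite /s -powRN -powRrM -{2}(powRr1 (ltW t0)) -powRD ?(gt_eqF t0) ?implybT//.
    by congr (_ `^ _); field; rewrite gt_eqF.
  rewrite -mulrDr ler_pM2l// /E /Num.max; case: ifP => _.
    by rewrite lerDr powR_ge0.
  by rewrite lerDl powR_ge0.
have Z0 : 0 <= Z.
  apply: sumr_ge0 => c _; apply: mulr_ge0; first exact: sample_weight_ge0.
  apply: (@sup_deviation_ge0 _ _ _ _ q0 q1 _ _ _ D m0).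
    have [f Lf] := Lne; exists (fun t => 0 * f t + 0 * f t); split; first exact: Lcomb.
    rewrite /pmean big1// => c' _.
    by rewrite !mul0r addr0 normr0 powR0 ?mulr0// gt_eqF.
  move=> f c' [Lf f1]; rewrite powR_ge0/=; apply: (le_trans (Lbound _ _ Lf)).
  by rewrite -[leRHS]mulr1 ler_pM2l.
have Zle : 2 * C1 / E * (1 + Z) <= 2 * C1 / E + Z / 2.
  by have := ler_wpM2r Z0 half; rewrite (mulrDr (2 * C1 / E)) mulr1; lra.
have C1E : 2 * C1 / E <= 2 * C1 * s by rewrite ler_wpM2l// mulr_ge0.
have tail2 : 2 * C0 * (t * E `^ (p - 1)) <= 2 * C0 * (t * E0 `^ (p - 1) + s).
  by rewrite ler_wpM2l// mulr_ge0.
have P0 : 0 <= E0 `^ (p - 1) by exact: powR_ge0.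
set P := E0 `^ (p - 1) in tail2 P0 *.
have : Z <= 4 * C1 * s + 4 * C0 * (t * P + s) by lra.
move=> /le_trans; apply.
have := mulr_ge0 (mulr_ge0 C00 P0) (ltW s0).
have := mulr_ge0 C10 (ltW t0).
have := mulr_ge0 C00 (ltW t0).
lra.
Qed.

End finite_sampling.

(** * Quantization of a compact space *)

Section coefficient_bound.
Context {R : realType} {T : Type} (N : nat) (e : 'I_N -> T -> R).
Hypothesis e_free : forall a : 'I_N -> R, \sum_(i < N) a i *: e i = 0 -> forall i, a i = 0.

Lemma sum_scale_apply (a : 'I_N -> R) (t : T) :
  (\sum_(i < N) a i *: e i) t = \sum_(i < N) a i * e i t.
Proof. by rewrite fct_sumE; apply: eq_bigr. Qed.

Definition evaluation_matrix n (x : 'I_n -> T) : 'M[R]_(n, N) := \matrix_(k, i) e i (x k).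

(** Points are added greedily: below full rank some nonzero combination of the [e i] vanishes at all
    chosen points. By freeness it is nonzero at some [t], and the row of [t] raises the rank. *)
Lemma evaluation_full : exists n (x : 'I_n -> T), row_full (evaluation_matrix x).
Proof.
suff H k : (k <= N)%N -> exists n (x : 'I_n -> T), (k <= \rank (evaluation_matrix x))%N.
  have [n [x rx]] := H N (leqnn N); exists n, x.
  by rewrite /row_full eqn_leq rank_leq_col.
elim: k => [_|k IH kN].
  by exists 0%N, (fun i : 'I_0 => False_rect T (notF (ltn_ord i))).
have [n [x rx]] := IH (ltnW kN).
have [kr|rk] := ltnP k (\rank (evaluation_matrix x)); first by exists n, x.
set A := evaluation_matrix x in rx rk.
have Ank : kermx A^T != 0.
  rewrite -mxrank_eq0 mxrank_ker mxrank_tr -lt0n subn_gt0.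
  exact: leq_ltn_trans rk kN.
have [v /sub_kermxP vA v0] := rowV0Pn Ank.
have [t vt] : exists t, \sum_(i < N) v 0 i * e i t != 0.
  apply: contrapT => /forallNP vt.
  case/negP: v0; apply/eqP/rowP => i; rewrite mxE.
  apply: e_free => //; apply/funext => t; rewrite sum_scale_apply.
  by apply/eqP/negPn/negP; exact: vt.
pose x' (k : 'I_(n + 1)) := match fintype.split k with inl j => x j | inr _ => t end.
exists (n + 1)%N, x'.
have -> : evaluation_matrix x' = col_mx A (\row_i e i t).
  apply/matrixP => i j; rewrite !mxE /x'; by case: (fintype.split i) => l; rewrite !mxE.
have sub : (A < col_mx A (\row_i e i t))%MS.
  rewrite /ltmx col_mx_sub submx_refl/=.
  rewrite -addsmxE addsmxSl/=; apply/negP => /submxP[w wE].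
  case/eqP: vt.
  have : (\row_i e i t) *m v^T = 0 by rewrite wE -mulmxA -(trmxK A) -trmx_mul vA trmx0 mulmx0.
  move=> /matrixP/(_ 0 0); rewrite !mxE => h; rewrite -[RHS]h.
  by apply: eq_bigr => i _; rewrite !mxE mulrC.
exact: leq_ltn_trans rx (rank_ltmx sub).
Qed.

(** The coefficients are fixed linear functions of the values at finitely many points, through the
    pseudo-inverse of the evaluation matrix. *)
Lemma coefficient_bound : exists2 A : R, 0 <= A &
  forall (a : 'I_N -> R) (b : R), (forall t, `|\sum_(i < N) a i * e i t| <= b) ->
  forall i, `|a i| <= A * b.
Proof.
have [n [x /mulVpmx fx]] := evaluation_full.
set B := pinvmx _ in fx.
exists (\sum_i \sum_k `|B i k|); first by do 2 apply: sumr_ge0 => ? _.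
move=> a b ab i.
have b0 k : `|\sum_(j < N) a j * e j (x k)| <= b by exact: ab.
have aE : a i = \sum_k B i k * \sum_(j < N) a j * e j (x k).
  transitivity ((B *m evaluation_matrix x *m \col_j a j) i 0).
    by rewrite fx mul1mx mxE.
  rewrite -mulmxA mxE; apply: eq_bigr => k _; congr (_ * _); rewrite mxE.
  by apply: eq_bigr => j _; rewrite !mxE mulrC.
apply: (@le_trans _ _ (\sum_k `|B i k| * b)).
  rewrite {1}aE; apply: (le_trans (ler_norm_sum _ _ _)); apply: ler_sum => k _.
  by rewrite normrM ler_wpM2l.
(* Without evaluation points the sign of [b] is unknown, but then all sums over [k] are empty. *)
rewrite -mulr_suml; case: (posnP n) => [n0|n0].
  have e0 (F : 'I_n -> R) : \sum_k F k = 0.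
    by apply: big1 => k _; have := ltn_ord k; rewrite {2}n0.
  rewrite e0 mul0r big1 ?mul0r// => ? _; exact: e0.
have bb : 0 <= b by exact: le_trans (b0 (Ordinal n0)).
rewrite ler_wpM2r// (bigD1 i)//= lerDl; by do 2 apply: sumr_ge0 => ? _.
Qed.

End coefficient_bound.

(** * Integrals of functions with finitely many values *)

Section integration.
Context d (T : measurableType d) (R : realType) (mu : {measure set T -> \bar R}).

(* No measurability: for nonnegative functions the integral is a supremum of
   integrals of simple functions below the integrand. *)
Lemma ge0_le_integral_outer (f g : T -> \bar R) :
  (forall x, (0 <= f x)%E) -> (forall x, (f x <= g x)%E) ->
  (\int[mu]_x f x <= \int[mu]_x g x)%E.
Proof.
move=> f0 fg; have g0 x : (0 <= g x)%E by exact: le_trans (f0 x) (fg x).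
rewrite !ge0_integralTE//; apply: ereal_sup_le => _ [h hf <-].
by exists h => // x; exact: le_trans (hf x) (fg x).
Qed.

Lemma integral_simple_sum (C : finType) (A : C -> set T) (g : C -> R) :
  (forall c, measurable (A c)) -> (forall c, 0 <= g c) ->
  (\int[mu]_x (\sum_c g c * \1_(A c) x)%:E = \sum_c (g c)%:E * mu (A c))%E.
Proof.
move=> mA g0.
under eq_integral do rewrite -sumEFin.
rewrite ge0_integral_sum//=.
- apply: eq_bigr => c _; under eq_integral do rewrite EFinM.
  rewrite ge0_integralZl_EFin//.
  + by rewrite integral_indic// setIT.
  + by apply/measurable_EFinP.
- move=> c; apply/measurable_EFinP; apply: measurable_funM => //.
- by move=> c x _; rewrite lee_fin mulr_ge0.
Qed.

Lemma measurable_simple_sum (C : finType) (A : C -> set T) (g : C -> R) :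
  (forall c, measurable (A c)) ->
  measurable_fun setT (fun x => \sum_c g c * \1_(A c) x).
Proof.
move=> mA; apply: measurable_sum => c; apply: measurable_funM => //.
Qed.

Lemma simple_sum_fiber (C : finType) (k : T -> C) (g : C -> R) x :
  \sum_c g c * \1_(k @^-1` [set c]) x = g (k x).
Proof.
rewrite (bigD1 (k x))//= indicE mem_set// mulr1 big1 ?addr0// => c ck.
by rewrite indicE memNset ?mulr0// => /= kx; rewrite kx eqxx in ck.
Qed.

Lemma pnorm_powR (p : R) (f : T -> R) : 0 < p -> f \in Lfun mu p%:E ->
  ((pnorm mu p f `^ p)%:E = \int[mu]_x (`|f x| `^ p)%:E)%E.
Proof.
move=> p0 fL; rewrite /pnorm.
have := sub_Lfun_finLfun fL; rewrite inE/= /finite_norm => fin.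
rewrite -fine_poweR fineK; first by rewrite powR_Lnorm ?gt_eqF.
by apply: fin_num_poweR; rewrite ge0_fin_numE; [exact: fin|exact: Lnorm_ge0].
Qed.

End integration.

Section compact_functions.
Context {R : realType} (Omega : ptopologicalType).
Hypothesis compactT : compact [set: Omega].

Lemma continuous_norm_bounded (f : Omega -> R) : continuous f ->
  exists b, forall t, `|f t| <= b.
Proof.
move=> cf.
have cfT : compact (f @` setT).
  by apply: continuous_compact => //; exact: continuous_subspaceT.
have [b [_ bP]] := @compact_bounded R R _ cfT.
exists (b + 1) => t; apply: (bP (b + 1)); first by rewrite ltrDl.
by exists t.
Qed.

Lemma norm_le_supnorm (f : Omega -> R) t : continuous f -> `|f t| <= supnorm f.
Proof.
move=> /continuous_norm_bounded[b bP].
have := @sup_image_ge R Omega setT (fun x => `|f x|) b (fun x _ => bP x) t I.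
by rewrite /supnorm/=.
Qed.

(** A cell is a common level box of all the [e i]: each value, shifted by [b'] to be nonnegative, is
    rounded down to a multiple of [eta]. This keeps the cells measurable. *)
Lemma finite_cells (N : nat) (e : 'I_N -> Omega -> R) (eta : R) : 0 < eta ->
  (forall i, continuous (e i)) ->
  (forall i, measurable_fun setT (e i : borel Omega -> R)) ->
  exists (C : finType) (cell : borel Omega -> C) (y : C -> Omega),
    (forall c, measurable (cell @^-1` [set c])) /\
    (forall i t, `|e i t - e i (y (cell t))| <= eta).
Proof.
move=> eta0 ce me.
have [b bP] := choice (fun i => continuous_norm_bounded (ce i)).
pose b' := \sum_i b i.
have b0 i : 0 <= b i := le_trans (normr_ge0 _) (bP i point).
have bb i : b i <= b' by rewrite /b' (bigD1 i)//= lerDl sumr_ge0.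
have eb i t : - b' <= e i t <= b' by rewrite -ler_norml (le_trans (bP i t)).
pose D := Num.truncn (2 * b' / eta).
pose z i t := (e i t + b') / eta.
have z0 i t : 0 <= z i t.
  by rewrite divr_ge0 ?(ltW eta0)//; case/andP: (eb i t) => *; lra.
have zD i t : (Num.truncn (z i t) < D.+1)%N.
  rewrite ltnS /D truncn_ge_nat ?divr_ge0 ?mulr_ge0 ?(ltW eta0)//; last first.
    by rewrite (le_trans (normr_ge0 (e i t))) ?ler_norml.
  have := truncn_itv (z0 i t) => /andP[h _]; apply: (le_trans h).
  by rewrite ler_pM2r ?invr_gt0//; case/andP: (eb i t) => *; lra.
pose cell t : {ffun 'I_N -> 'I_D.+1} := [ffun i => Ordinal (zD i t)].
(* Empty cells receive the default [point]; only cells of the form [cell t] are used in the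
   estimate. *)
pose y (c : {ffun 'I_N -> 'I_D.+1}) : Omega := xget point [set t | cell t = c].
exists {ffun 'I_N -> 'I_D.+1}, cell, y; split.
  move=> c.
  have -> : cell @^-1` [set c] = \bigcap_(i in [set: 'I_N])
      (e i @^-1` `[(c i)%:R * eta - b', (c i).+1%:R * eta - b'[%classic).
    apply/seteqP; split=> [t /= ct i _|t /= ct].
      rewrite /= in_itv/= lerBlDr ltrBrDr -ler_pdivlMr// -ltr_pdivrMr//.
      by rewrite -ct ffunE/= truncn_itv.
    apply/ffunP => i; apply/val_inj; rewrite ffunE/=.
    have := ct i I; rewrite /= in_itv/= lerBlDr ltrBrDr -ler_pdivlMr// -ltr_pdivrMr// => h.
    by rewrite (truncn_def h).
  apply: fin_bigcap_measurable; first exact: finite_finset.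
  move=> i _.
  by rewrite -[X in measurable X]setTI; apply: me => //; exact: measurable_itv.
move=> i t.
have yt : cell (y (cell t)) = cell t.
  by apply: (@xgetI _ point [set t' | cell t' = cell t] t).
have : Num.truncn (z i (y (cell t))) = Num.truncn (z i t).
  by have /ffunP/(_ i) := yt; rewrite !ffunE => -[].
move=> E; have := truncn_itv (z0 i (y (cell t))); have := truncn_itv (z0 i t).
rewrite E -natr1; move: (_%:R) => n.
rewrite !ler_pdivlMr// !ltr_pdivrMr// => /andP[? ?] /andP[? ?].
by rewrite ler_norml; apply/andP; split; lra.
Qed.

End compact_functions.

(** * Replacing the measure by the masses of finitely many cells *)

Section sampling_domination.
Context {R : realType}.

Lemma integral_le_shift d (T : measurableType d) (mu : probability T R)
    (F G : T -> R) (tau a b : R) :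
  measurable_fun setT G -> (forall x, 0 <= F x) -> (forall x, 0 <= G x) -> 0 <= tau ->
  (forall x, F x <= G x + tau) ->
  (\int[mu]_x (F x)%:E = a%:E)%E -> (\int[mu]_x (G x)%:E = b%:E)%E -> a <= b + tau.
Proof.
move=> mG F0 G0 tau0 FG Fa Gb; rewrite -lee_fin -Fa EFinD -Gb.
have -> : (tau%:E = \int[mu]_x tau%:E)%E.
  by rewrite integral_cst//= probability_setT mule1.
rewrite -ge0_integralD//=; first last.
- exact/measurable_EFinP.
- by move=> x _; rewrite lee_fin.
apply: ge0_le_integral_outer => x; rewrite ?lee_fin//.
Qed.

Lemma integral_diff_le d (T : measurableType d) (mu : probability T R)
    (F G : T -> R) (tau a b : R) :
  measurable_fun setT F -> measurable_fun setT G ->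
  (forall x, 0 <= F x) -> (forall x, 0 <= G x) ->
  (forall x, `|F x - G x| <= tau) ->
  (\int[mu]_x (F x)%:E = a%:E)%E -> (\int[mu]_x (G x)%:E = b%:E)%E -> `|a - b| <= tau.
Proof.
move=> mF mG F0 G0 FG Fa Gb.
have tau0 : 0 <= tau by exact: le_trans (normr_ge0 _) (FG point).
have FG1 x : F x <= G x + tau by move: (FG x); rewrite ler_norml => /andP[_]; lra.
have FG2 x : G x <= F x + tau by move: (FG x); rewrite ler_norml => /andP[+ _]; lra.
have := integral_le_shift mG F0 G0 tau0 FG1 Fa Gb.
have := integral_le_shift mF G0 F0 tau0 FG2 Gb Fa.
by move=> ? ?; rewrite ler_norml; apply/andP; split; lra.
Qed.

Context (p : R) (p2 : 2 <= p).

Let p1 : 1 < p. Proof. by rewrite (lt_le_trans _ p2)// ltr1n. Qed.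
Let p0 : 0 < p. Proof. by rewrite (lt_trans _ p1). Qed.

Section fixed_subspace.
Context (Omega : ptopologicalType) (mu : probability (borel Omega) R).
Context (N : nat) (M : R) (L : set (Omega -> R)) (e : 'I_N -> Omega -> R).
Hypothesis N_gt0 : (0 < N)%N.
Hypothesis compactT : compact [set: Omega].
Hypothesis L_Lfun : forall f, L f -> f \in Lfun mu p%:E /\ continuous f.
Hypothesis e_free : forall a : 'I_N -> R, \sum_(i < N) a i *: e i = 0 -> forall i, a i = 0.
Hypothesis L_span : L = [set \sum_(i < N) a i *: e i | a in [set: 'I_N -> R]].
Hypothesis L_nikolskii : forall f, L f -> supnorm f <= M * N%:R `^ p^-1 * pnorm mu p f.

Let K : R := M * N%:R `^ p^-1.
Local Notation s := (pnorm mu p).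

Lemma pnorm_ge0 f : 0 <= s f.
Proof. by rewrite fine_ge0// Lnorm_ge0. Qed.

Lemma span_in (a : 'I_N -> R) : L (\sum_(i < N) a i *: e i).
Proof. by rewrite L_span; exists a. Qed.

Lemma span_basis i : L (e i).
Proof.
have -> : e i = \sum_(j < N) (j == i)%:R *: e j.
  rewrite (bigD1 i)//= eqxx scale1r big1 ?addr0// => j /negbTE ->.
  by rewrite scale0r.
exact: span_in.
Qed.

Lemma span_comb a b f g : L f -> L g -> L (fun t => a * f t + b * g t).
Proof.
rewrite L_span => -[v _ <-] [w _ <-]; exists (fun i => a * v i + b * w i) => //.
apply/funext => t; rewrite !sum_scale_apply !mulr_sumr -big_split/=.
by apply: eq_bigr => i _; rewrite mulrDl !mulrA.
Qed.

Lemma norm_le_pnorm f t : L f -> `|f t| <= K * s f.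
Proof.
move=> Lf; have [_ cf] := L_Lfun Lf.
exact: le_trans (norm_le_supnorm compactT t cf) (L_nikolskii Lf).
Qed.

Lemma measurable_in_L f : L f -> measurable_fun setT (f : borel Omega -> R).
Proof.
by move=> /L_Lfun[/sub_Lfun_mfun + _]; rewrite inE.
Qed.

Lemma measurable_norm_powR d (T : measurableType d) (f : T -> R) :
  measurable_fun setT f -> measurable_fun setT (fun x => `|f x| `^ p).
Proof.
move=> mf; apply: (@measurableT_comp _ _ _ _ _ _ (@powR R ^~ p)) => //.
exact: measurableT_comp.
Qed.

Lemma integral_pnorm f : L f ->
  (\int[mu]_x (`|f x| `^ p)%:E = (s f `^ p)%:E)%E.
Proof. by move=> Lf; rewrite -pnorm_powR//; have [] := L_Lfun Lf. Qed.

(** No sign of [M] is assumed in the theorem; positivity comes from a basis function that is nonzero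
    somewhere. Integrating [|f|^p <= M^p N ||f||_p^p] against a probability gives the second part,
    the condition [D >= 1] of the finite estimate. *)
Lemma nikolskii_const : 0 < M /\ 1 <= M `^ p * N%:R.
Proof.
have i0 : 'I_N := Ordinal N_gt0.
have Le := span_basis i0.
have [t et] : exists t, e i0 t != 0.
  apply: contrapT => /forallNP et.
  have : \sum_(i < N) (i == i0)%:R *: e i = 0.
    rewrite (bigD1 i0)//= eqxx scale1r big1 => [|j /negbTE ->]; last by rewrite scale0r.
    by rewrite addr0; apply/funext => t; apply/eqP/negPn/negP; exact: et.
  by move=> /e_free/(_ i0)/eqP; rewrite eqxx oner_eq0.
have NR : 0 < N%:R `^ p^-1 :> R by rewrite powR_gt0// ltr0n.
have Ks : 0 < K * s (e i0).
  by rewrite (lt_le_trans _ (norm_le_pnorm t Le))// normr_gt0.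
have s0 : 0 < s (e i0).
  rewrite lt0r pnorm_ge0 andbT; apply: contraTneq Ks => ->.
  by rewrite mulr0 ltxx.
have K0 : 0 < K by rewrite -(pmulr_lgt0 _ s0).
have M0 : 0 < M by rewrite -(pmulr_lgt0 _ NR).
split=> //.
have Kp : K `^ p = M `^ p * N%:R.
  by rewrite powRM ?(ltW M0) ?powR_ge0// -powRrM mulVf ?gt_eqF// powRr1.
rewrite -Kp -(ler_pM2r (_ : 0 < s (e i0) `^ p)) ?powR_gt0// mul1r.
have -> : K `^ p * s (e i0) `^ p = 0 + (K * s (e i0)) `^ p.
  by rewrite add0r [in RHS]powRM// ltW.
apply: (@integral_le_shift _ _ mu (fun x => `|e i0 x| `^ p) (fun=> 0)) => //.
- by rewrite powR_ge0.
- move=> x; rewrite add0r ge0_ler_powR ?nnegrE ?(ltW p0) ?(ltW Ks)//.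
  exact: norm_le_pnorm.
- exact: integral_pnorm.
- by rewrite integral0.
Qed.

(** The error is relative to the norm of [f], hence uniform over [L]. The mesh depends on the basis
    through [A], which is harmless: neither the mesh nor the number of cells enters the final
    constants. *)
Lemma span_quantization (theta : R) : 0 < theta ->
  exists (C : finType) (cell : borel Omega -> C) (y : C -> Omega),
    (forall c, measurable (cell @^-1` [set c])) /\
    (forall f t, L f -> `| `|f t| `^ p - `|f (y (cell t))| `^ p| <= theta * s f `^ p).
Proof.
move=> theta0.
have [M0 _] := nikolskii_const.
have NR : 0 < N%:R `^ p^-1 :> R by rewrite powR_gt0// ltr0n.
have K0 : 0 < K by rewrite mulr_gt0.
have [A A0 coef] := coefficient_bound e_free.
(* Product of the Lipschitz constant [p (K s)^(p-1)] and the oscillation [N A K s] per unit of mesh,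
   divided by [s^p], where [s] is the norm of [f]. The mesh uses [c1 + 1] to avoid a division by
   zero. *)
pose c1 : R := p * (N%:R * A * K `^ p).
have c10 : 0 <= c1 by rewrite mulr_ge0 ?(ltW p0)// !mulr_ge0 ?powR_ge0.
have eta0 : 0 < theta / (c1 + 1) by rewrite divr_gt0// ltr_wpDl.
have [C [cell [y [mcell close]]]] := finite_cells compactT eta0
  (fun i => (L_Lfun (span_basis i)).2) (fun i => measurable_in_L (span_basis i)).
exists C, cell, y; split=> // f t Lf.
have s0 : 0 <= s f := pnorm_ge0 f.
have fK := fun t => norm_le_pnorm t Lf.
have osc : `|f t - f (y (cell t))| <= N%:R * A * (K * s f) * (theta / (c1 + 1)).
  move: Lf fK; rewrite {1}L_span => -[a _ <-] fK.
  have aA i : `|a i| <= A * (K * s (\sum_(i < N) a i *: e i)).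
    by apply: coef => u; rewrite -sum_scale_apply.
  set S := s _ in aA *.
  rewrite !sum_scale_apply -sumrB; apply: (le_trans (ler_norm_sum _ _ _)).
  apply: (@le_trans _ _ (\sum_(i < N) A * (K * S) * (theta / (c1 + 1)))).
    apply: ler_sum => i _; rewrite -mulrBr normrM.
    apply: ler_pM; [exact: normr_ge0|exact: normr_ge0|exact: aA|exact: close].
  by rewrite sumr_const card_ord -[leLHS]mulr_natl !mulrA.
have Ks0 : 0 <= K * s f by rewrite mulr_ge0// ltW.
apply: (le_trans (powR_lipschitz p1 _ _ (fK t) (fK (y (cell t))))) => //.
apply: (@le_trans _ _ (p * (K * s f) `^ (p - 1) * `|f t - f (y (cell t))|)).
  rewrite ler_wpM2l ?ler_dist_dist// mulr_ge0 ?powR_ge0 ?(ltW p0)//.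
apply: (@le_trans _ _ (p * (K * s f) `^ (p - 1) *
    (N%:R * A * (K * s f) * (theta / (c1 + 1))))).
  by rewrite ler_wpM2l// mulr_ge0 ?powR_ge0 ?(ltW p0).
have -> : p * (K * s f) `^ (p - 1) * (N%:R * A * (K * s f) * (theta / (c1 + 1))) =
    p * (N%:R * A * ((K * s f) * (K * s f) `^ (p - 1))) * (theta / (c1 + 1)) by ring.
rewrite (mulr_powRB1 Ks0 p0) powRM ?(ltW K0)//.
have -> : p * (N%:R * A * (K `^ p * s f `^ p)) * (theta / (c1 + 1)) =
    theta * s f `^ p * (c1 / (c1 + 1)) by rewrite /c1; ring.
rewrite -[leRHS]mulr1 ler_wpM2l ?mulr_ge0 ?powR_ge0 ?(ltW theta0)//.
by rewrite ler_pdivrMr ?mul1r ?ltr_wpDl// lerDl.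
Qed.

Section quantized.
Context (C : finType) (cell : borel Omega -> C) (y : C -> Omega).
Hypothesis mcell : forall c, measurable (cell @^-1` [set c]).

Definition cell_mass (c : C) : R := fine (mu (cell @^-1` [set c])).

Lemma cell_mass_ge0 c : 0 <= cell_mass c.
Proof. by rewrite fine_ge0. Qed.

Lemma cell_massE c : (cell_mass c)%:E = mu (cell @^-1` [set c]).
Proof. by rewrite fineK// fin_num_measure. Qed.

Lemma integral_cells (g : C -> R) : (forall c, 0 <= g c) ->
  (\int[mu]_t (g (cell t))%:E = (\sum_c cell_mass c * g c)%:E)%E.
Proof.
move=> g0; under eq_integral => t _ do rewrite -(simple_sum_fiber cell g t).
rewrite (integral_simple_sum mu mcell g0) -sumEFin; apply: eq_bigr => c _.
by rewrite EFinM muleC cell_massE.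
Qed.

Lemma sum_cell_mass : \sum_c cell_mass c = 1.
Proof.
apply: EFin_inj; have := @integral_cells (fun=> 1) (fun _ => ler01).
under [in RHS]eq_bigr do rewrite mulr1.
by move=> <-; rewrite integral_cst//= probability_setT mule1.
Qed.

Lemma pmean_cells f theta : L f ->
  (forall t, `| `|f t| `^ p - `|f (y (cell t))| `^ p| <= theta) ->
  `|s f `^ p - pmean p cell_mass y f| <= theta.
Proof.
move=> Lf close.
apply: (@integral_diff_le _ _ mu (fun t => `|f t| `^ p)
  (fun t => `|f (y (cell t))| `^ p)) => //.
- by apply: measurable_norm_powR; exact: measurable_in_L.
- rewrite (_ : (fun t => _) = fun t => \sum_c `|f (y c)| `^ p * \1_(cell @^-1` [set c]) t).
    exact: measurable_simple_sum.
  by apply/funext => t; rewrite (simple_sum_fiber cell (fun c => `|f (y c)| `^ p)).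
- exact: integral_pnorm.
- by rewrite (integral_cells (g := fun c => `|f (y c)| `^ p)).
Qed.

Context (m : nat) d (S : measurableType d) (P : probability S R).
Context (X : 'I_m -> {RV P >-> borel Omega}).
Hypothesis iidX : iid_sample mu X.

Definition cell_sample (w : S) : {ffun 'I_m -> C} := [ffun j => cell (X j w)].

Lemma cell_sample_fiber c : cell_sample @^-1` [set c] =
  \bigcap_(j in [set` [set: 'I_m]%SET]) (X j @^-1` (cell @^-1` [set c j])).
Proof.
apply/seteqP; split=> [w /= <- j _|w h]; first by rewrite /= ffunE.
by apply/ffunP => j; rewrite ffunE; apply: h => /=; rewrite inE.
Qed.

Lemma measurable_cell_sample c : measurable (cell_sample @^-1` [set c]).
Proof.
rewrite cell_sample_fiber; apply: fin_bigcap_measurable; first exact: finite_finset.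
move=> j _; rewrite -[X in measurable X]setTI.
by apply: (measurable_funP (X j)) => //; exact: mcell.
Qed.

Lemma cell_sample_law c : P (cell_sample @^-1` [set c]) = (sample_weight cell_mass c)%:E.
Proof.
have [indep law] := iidX.
rewrite cell_sample_fiber.
rewrite (indep [set: 'I_m]%SET (fun j => cell @^-1` [set c j])); last first.
  by move=> j _; exact: mcell.
rewrite /sample_weight -prodEFin; apply: eq_big => [j|j _]; first by rewrite inE.
by rewrite cell_massE -(law j).
Qed.

Lemma integral_cell_sample (g : {ffun 'I_m -> C} -> R) : (forall c, 0 <= g c) ->
  (\int[P]_w (g (cell_sample w))%:E = (\sum_c sample_weight cell_mass c * g c)%:E)%E.
Proof.
move=> g0; under eq_integral => t _ do rewrite -(simple_sum_fiber cell_sample g t).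
rewrite (integral_simple_sum P measurable_cell_sample g0) -sumEFin; apply: eq_bigr => c _.
by rewrite [in RHS]EFinM -cell_sample_law [in RHS]muleC.
Qed.

End quantized.

End fixed_subspace.
End sampling_domination.

Section domination.
Context {R : realType} (p : R) (p2 : 2 <= p).

Let p1 : 1 < p. Proof. by rewrite (lt_le_trans _ p2)// ltr1n. Qed.
Let p0 : 0 < p. Proof. by rewrite (lt_trans _ p1). Qed.

(** Since [ln m >= ln 2] and [p >= 2], the exponent can be raised from 2 to [p] at the cost of a
    constant. *)
Lemma ln_sqr_le_powR (m : nat) : (2 <= m)%N ->
  ln m%:R ^+ 2 <= (ln 2) `^ (2 - p) * ln m%:R `^ p.
Proof.
move=> m2; have lm := ln_nat_ge2 (R := R) m2.
have l0 := ln2_gt0 (R := R).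
have lm0 : 0 < ln m%:R :> R by exact: lt_le_trans lm.
have -> : ln m%:R ^+ 2 = ln m%:R `^ (2 - p) * ln m%:R `^ p :> R.
  rewrite -powRD ?(gt_eqF lm0) ?implybT// subrK -powR_mulrn//.
  exact: ltW.
apply: ler_wpM2r; first exact: powR_ge0.
rewrite -(opprB p 2) !powRN lef_pV2 ?posrE ?powR_gt0//.
by rewrite ge0_ler_powR ?nnegrE ?subr_ge0 ?(ltW l0) ?(ltW lm0).
Qed.

(* The measurable majorant [g] avoids any measurability question for the
   supremum over the unit ball. *)
Lemma sampling_domination : exists2 K : R, 0 <= K &
  forall (Omega : ptopologicalType) (mu : probability (borel Omega) R)
    (N : nat) (M : R) (L : set (Omega -> R)),
  (0 < N)%N -> compact [set: Omega] ->
  (forall f, L f -> f \in Lfun mu p%:E /\ continuous f) ->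
  subspace_of_dim N L ->
  (forall f, L f -> supnorm f <= M * N%:R `^ p^-1 * pnorm mu p f) ->
  forall (m : nat) (t : R), (2 <= m)%N -> t = ln m%:R `^ p / m%:R * M `^ p * N%:R ->
  forall (d : measure_display) (S : measurableType d)
    (P : probability S R) (X : 'I_m -> {RV P >-> borel Omega}),
  iid_sample mu X ->
  exists g : S -> R, [/\ measurable_fun setT g, forall w, 0 <= g w,
    (\int[P]_w (g w)%:E <= (K * (t + t `^ p^-1))%:E)%E &
    forall w f, L f -> `|sample_mean p (X ^~ w) f - pnorm mu p f `^ p| <=
      g w * pnorm mu p f `^ p].
Proof.
have [Cp Cp0 finite] := finite_sampling p2.
(* The factor 2 comes from the constant [2 * D] of the quantized space, the power of [ln 2] from
   [ln_sqr_le_powR]. *)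
pose kappa : R := 2 * (ln 2) `^ (2 - p).
have l20 := ln2_gt0 (R := R).
have kappa0 : 0 < kappa by rewrite mulr_gt0// powR_gt0.
have kp0 : 0 <= kappa `^ p^-1 by exact: powR_ge0.
exists (2 * Cp * (kappa + kappa `^ p^-1) + 1).
  by rewrite addr_ge0// mulr_ge0 ?mulr_ge0 ?addr_ge0 ?(ltW kappa0).
move=> Omega mu N M L N0 cT LL [e [ef Ls]] Ln m t m2 tE d S P X iidX.
have m0 : (0 < m)%N by rewrite (ltn_trans _ m2).
have mR : 0 < m%:R :> R by rewrite ltr0n.
have [M0 D1] := nikolskii_const p2 N0 cT LL ef Ls Ln.
set D := M `^ p * N%:R in D1.
have D0 : 0 < D by rewrite (lt_le_trans _ D1).
have lm := ln_nat_ge2 (R := R) m2.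
have lm0 : 0 < ln m%:R :> R by exact: lt_le_trans lm.
have t0 : 0 < t.
  by rewrite tE -(mulrA _ (M `^ p)) -/D mulr_gt0// divr_gt0// powR_gt0.
pose u := t `^ p^-1.
have u0 : 0 < u by rewrite powR_gt0.
(* [1 / 2] makes the quantized and true norms comparable up to a factor 2 in [p]-th power; [u / 2]
   hides the quantization error in the term [t^(1/p)]. *)
pose theta := Num.min (1 / 2) (u / 2).
have theta0 : 0 < theta by rewrite lt_min !divr_gt0.
have thetah : theta <= 1 / 2 by rewrite ge_min lexx.
have thetau : theta <= u / 2 by rewrite ge_min lexx orbT.
have [C [cell [y [mcell close]]]] := span_quantization p2 N0 cT LL ef Ls Ln theta0.
pose q := cell_mass mu cell.
have q0 : forall c, 0 <= q c := cell_mass_ge0 mu cell.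
have q1 : \sum_c q c = 1 := sum_cell_mass mu mcell.
have Lcomb a b f g : L f -> L g -> L (fun x => a * f x + b * g x) by exact: (span_comb Ls).
have Lne : L !=set0 by exists (\sum_(i < N) 0 *: e i); rewrite Ls; exists (fun=> 0).
have sp0 f : 0 <= pnorm mu p f `^ p by exact: powR_ge0.
have mean_close f : L f -> `|pnorm mu p f `^ p - pmean p q y f| <=
    theta * pnorm mu p f `^ p.
  by move=> Lf; apply: (pmean_cells p2 LL mcell Lf) => x; exact: close.
have thalf f : theta * pnorm mu p f `^ p <= 1 / 2 * pnorm mu p f `^ p.
  exact: ler_wpM2r.
have D21 : 1 <= 2 * D by lra.
have Lbound f x : L f -> `|f x| `^ p <= 2 * D * pmean p q y f.
  move=> Lf; have := norm_le_pnorm cT LL Ln x Lf => fx.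
  have h1 : `|f x| `^ p <= D * pnorm mu p f `^ p.
    have -> : D * pnorm mu p f `^ p = (M * N%:R `^ p^-1 * pnorm mu p f) `^ p.
      rewrite !powRM ?mulr_ge0 ?powR_ge0 ?pnorm_ge0 ?(ltW M0)//.
      by rewrite -powRrM mulVf ?gt_eqF// powRr1.
    by rewrite ge0_ler_powR ?nnegrE ?(ltW p0)// (le_trans _ fx).
  have h2 : pnorm mu p f `^ p <= 2 * pmean p q y f.
    by have := mean_close f Lf; have := thalf f; rewrite ler_norml => ? /andP[_]; lra.
  by have := ler_wpM2l (ltW D0) h2; lra.
pose B := [set f | L f /\ pmean p q y f <= 1].
pose phi (f : Omega -> R) (c : C) := `|f (y c)| `^ p.
pose Z (c : {ffun 'I_m -> C}) := sup_deviation q B phi c.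
have Bne : B !=set0.
  have [f Lf] := Lne; exists (fun x => 0 * f x + 0 * f x); split; first exact: Lcomb.
  rewrite /pmean big1// => c _.
  by rewrite !mul0r addr0 normr0 powR0 ?mulr0// gt_eqF.
have phiB f c : B f -> 0 <= phi f c <= 2 * D.
  move=> [Lf f1]; rewrite powR_ge0/=; apply: (le_trans (Lbound _ _ Lf)).
  by rewrite -[leRHS]mulr1 ler_pM2l// (lt_le_trans _ D21).
have Z0 c : 0 <= Z c by exact (sup_deviation_ge0 q0 q1 m0 Bne phiB c).
(* [2 * Z] passes from the quantized norm to the true one; [2 * theta] pays for quantizing both the
   empirical mean and the norm. *)
pose g c := 2 * Z c + 2 * theta.
have g0 c : 0 <= g c by rewrite addr_ge0 ?mulr_ge0 ?(ltW theta0).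
exists (fun w => g (cell_sample cell X w)); split=> //.
- rewrite (_ : (fun w => _) = fun w => \sum_c g c * \1_(cell_sample cell X @^-1` [set c]) w).
    exact: measurable_simple_sum (measurable_cell_sample mcell X).
  by apply/funext => w; rewrite simple_sum_fiber.
- rewrite (integral_cell_sample mcell iidX g0) lee_fin -/q.
  have -> : \sum_c sample_weight q c * g c =
      2 * (\sum_c sample_weight q c * Z c) + 2 * theta.
    under eq_bigr do rewrite mulrDr (mulrCA _ 2).
    by rewrite big_split/= -mulr_sumr -mulr_suml sum_sample_weight// mul1r.
  pose t' := 2 * D * ln m%:R ^+ 2 / m%:R.
  have := finite C Omega q y L (2 * D) q0 q1 D21 Lne Lcomb Lbound m t' m2 erefl.
  rewrite -/B -/phi -/Z => EZ.
  have t't : t' <= kappa * t.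
    rewrite /t' tE /kappa.
    have -> : 2 * ln 2 `^ (2 - p) * (ln m%:R `^ p / m%:R * M `^ p * N%:R) =
      2 * D / m%:R * (ln 2 `^ (2 - p) * ln m%:R `^ p) by rewrite /D; ring.
    have -> : 2 * D * ln m%:R ^+ 2 / m%:R = 2 * D / m%:R * ln m%:R ^+ 2 by ring.
    by apply: ler_wpM2l; [rewrite divr_ge0// mulr_ge0 ?ltW|exact: ln_sqr_le_powR].
  have t'0 : 0 <= t'.
    by apply: divr_ge0 => //; apply: mulr_ge0; [rewrite mulr_ge0 ?ltW|exact: sqr_ge0].
  have t'u : t' `^ p^-1 <= kappa `^ p^-1 * u.
    rewrite /u -powRM ?(ltW kappa0) ?(ltW t0)//.
    have kt0 := mulr_ge0 (ltW kappa0) (ltW t0).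
    by apply: ge0_ler_powR; rewrite ?nnegrE ?invr_ge0 ?(ltW p0).
  have h : Cp * (t' + t' `^ p^-1) <= Cp * (kappa * t + kappa `^ p^-1 * u).
    by rewrite ler_wpM2l// lerD.
  rewrite -/u.
  have h1 := mulr_ge0 Cp0 (mulr_ge0 (ltW kappa0) (ltW u0)).
  have h2 := mulr_ge0 Cp0 (mulr_ge0 kp0 (ltW t0)).
  lra.
move=> w f Lf; set I := pnorm mu p f `^ p.
have I0 : 0 <= I by exact: powR_ge0.
set c := cell_sample cell X w.
have dev := deviation_homogeneous p2 q0 q1 D21 Lcomb Lbound c m0 Lf.
rewrite -/B -/phi -/(Z c) /deviation in dev.
have mc := mean_close f Lf; rewrite -/I in mc.
have Np2 : pmean p q y f <= 2 * I.
  by have := thalf f; rewrite -/I; move: mc; rewrite ler_norml => /andP[+ _]; lra.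
have emp : `|sample_mean p (X ^~ w) f - m%:R^-1 * \sum_(j < m) phi f (c j)| <= theta * I.
  rewrite /sample_mean -mulrBr -sumrB normrM ger0_norm ?invr_ge0 ?(ltW mR)//.
  rewrite ler_pdivrMl//; apply: (le_trans (ler_norm_sum _ _ _)).
  apply: (@le_trans _ _ (\sum_(j < m) theta * I)); last first.
    by rewrite sumr_const card_ord -[leLHS]mulr_natl.
  by apply: ler_sum => j _; rewrite /phi /c ffunE; exact: close.
have Zc := ler_wpM2l (Z0 c) Np2.
have := le_trans dev Zc.
have -> : g c * I = Z c * (2 * I) + 2 * (theta * I) by rewrite /g; ring.
move: emp mc; rewrite -/(pmean p q y f) !ler_norml.
move=> /andP[? ?] /andP[? ?] /andP[? ?]; apply/andP; split; lra.
Qed.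

End domination.

(** * From the expected deviation to the theorem *)

Section consequences.
Context {R : realType}.

Lemma ln_le_powR (b x : R) : 0 < b -> 0 < x -> ln x <= b^-1 * x `^ b.
Proof.
move=> b0 x0; rewrite ler_pdivlMl// -ln_powR ltW// ln_sublinear//.
exact: powR_gt0.
Qed.

Lemma half_le_ln2 : 1 / 2 <= ln 2 :> R.
Proof.
rewrite -ler_expR lnK ?posrE// -[1 / 2]opprK expRN.
rewrite -[leRHS]invrK lef_pV2 ?posrE ?expR_gt0 ?invr_gt0//.
by apply: le_trans (expR_ge1Dx _); lra.
Qed.

(* If [D <= sqrt m] then [t] is at most a negative power of [m >= c]; otherwise
   [ln m <= 2 ln (4 D)] and the hypothesis on [m] applies directly. *)
Lemma sample_size (p tau : R) : 2 <= p -> 0 < tau -> exists c : R,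
  forall (D : R) (m : nat), 1 <= D -> c * D * ln (4 * D) `^ p <= m%:R ->
  (2 <= m)%N /\ ln m%:R `^ p / m%:R * D <= tau.
Proof.
move=> p2 tau0; have p0 : 0 < p by lra.
pose a : R := (4 * p) `^ p.
have a0 : 0 < a by rewrite powR_gt0// mulr_gt0.
(* The summands give, in this order, [m >= 2], the case [D^2 <= m] and the case [D^2 > m]. In the
   former, [ln m <= 4 p m^(1/(4p))] yields [(ln m)^p D <= a m^(3/4)], which is at most [tau m] as
   soon as [m >= (a / tau)^4]. *)
exists (2 + (a / tau) ^+ 4 + 2 `^ p / tau).
move=> D m D1; set c := 2 + _ + _.
have D0 : 0 < D by lra.
have c2 : 2 `^ p / tau <= c.
  by have := exprn_ge0 4 (ltW (divr_gt0 a0 tau0)); rewrite /c; lra.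
have c4 : (a / tau) ^+ 4 <= c.
  by have := divr_ge0 (powR_ge0 2 p) (ltW tau0); rewrite /c; lra.
have c1 : 2 <= c.
  have := exprn_ge0 4 (ltW (divr_gt0 a0 tau0)).
  by have := divr_ge0 (powR_ge0 2 p) (ltW tau0); rewrite /c; lra.
have c0 : 0 < c by lra.
(* This is what the factor 4 is for: with it, the condition on [m] implies [m >= c]. *)
have l1 : 1 <= ln (4 * D).
  have -> : (4 : R) = 2 * 2 by ring.
  rewrite !lnM ?posrE ?mulr_gt0//; have := half_le_ln2.
  by have := ln_ge0 D1; lra.
have lp1 : 1 <= ln (4 * D) `^ p.
  apply: (@le_trans _ _ (1 `^ p)); first by rewrite powR1.
  by apply: ge0_ler_powR; rewrite ?nnegrE ?(ltW p0)// (le_trans _ l1).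
move=> mge.
have mc : c <= m%:R.
  apply: le_trans mge; rewrite -mulrA ler_peMr ?(ltW c0)//.
  by rewrite mulr_ege1.
have m2 : (2 <= m)%N by rewrite -(ler_nat R); exact: le_trans mc.
split=> //.
have mR : 0 < m%:R :> R by lra.
have m1 : 1 <= m%:R :> R by lra.
have lnm0 : 0 <= ln m%:R :> R by rewrite ln_ge0.
rewrite mulrAC ler_pdivrMr//.
have [Dm|mD] := leP (D ^+ 2) m%:R; last first.
  have lm : ln m%:R <= 2 * ln (4 * D).
    apply: (@le_trans _ _ (ln (D ^+ 2))).
      by rewrite ler_ln ?posrE ?exprn_gt0// ltW.
    rewrite lnXn// -[leLHS]mulr_natl ler_pM2l// ler_ln ?posrE ?mulr_gt0//.
    lra.
  have h : ln m%:R `^ p <= 2 `^ p * ln (4 * D) `^ p.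
    rewrite -powRM//; last by lra.
    by apply: ge0_ler_powR; rewrite ?nnegrE ?(ltW p0)//; lra.
  have h2 : ln m%:R `^ p * D <= 2 `^ p * (D * ln (4 * D) `^ p).
    by have := ler_wpM2r (ltW D0) h; lra.
  apply: (le_trans h2).
  have X0 : 0 <= D * ln (4 * D) `^ p by rewrite mulr_ge0 ?powR_ge0 ?ltW.
  have h3 : 2 `^ p <= tau * c by rewrite mulrC -ler_pdivrMr.
  apply: (le_trans (ler_wpM2r X0 h3)).
  by have := ler_wpM2l (ltW tau0) mge; lra.
pose b : R := (4 * p)^-1.
have b0 : 0 < b by rewrite invr_gt0 mulr_gt0.
pose r : R := m%:R `^ (4^-1).
have r0 : 0 < r by rewrite powR_gt0.
have r4 : r ^+ 4 = m%:R.
  by rewrite /r -powR_mulrn ?powR_ge0// -powRrM mulVf ?powRr1// pnatr_eq0.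
have Dr : D <= r ^+ 2.
  rewrite -(ler_sqr (x := D)) ?nnegrE ?exprn_ge0 ?(ltW D0) ?(ltW r0)//.
  by rewrite -exprM r4.
have lr : ln m%:R `^ p <= a * r.
  have : ln m%:R `^ p <= (b^-1 * m%:R `^ b) `^ p.
    apply: ge0_ler_powR; rewrite ?nnegrE ?(ltW p0)//.
      by apply: mulr_ge0; [rewrite invr_ge0; exact: ltW|exact: powR_ge0].
    exact: ln_le_powR.
  have -> : (b^-1 * m%:R `^ b) `^ p = a * r.
    have bi : 0 <= b^-1 by rewrite ltW// invr_gt0.
    rewrite (powRM _ bi (powR_ge0 _ _)) -powRrM /a /r.
    have -> : b * p = 4^-1 by rewrite /b; field; rewrite gt_eqF.
    by rewrite /b invrK.
  by [].
have ar : a <= tau * r.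
  rewrite mulrC -ler_pdivrMr// -(@ler_pXn2r _ 4) ?nnegrE ?divr_ge0
    ?(ltW a0) ?(ltW tau0) ?(ltW r0)//.
  by rewrite r4 (le_trans c4).
have r3 : ln m%:R `^ p * D <= a * r * r ^+ 2.
  by apply: ler_pM; rewrite ?powR_ge0 ?(ltW D0).
apply: (le_trans r3); rewrite -r4.
have -> : a * r * r ^+ 2 = a * r ^+ 3 by ring.
have -> : tau * r ^+ 4 = tau * r * r ^+ 3 by ring.
by rewrite ler_wpM2r// exprn_ge0 ?ltW.
Qed.

Lemma measurable_sublevel d (S : measurableType d) (g : S -> R) (v : R) :
  measurable_fun setT g -> measurable [set w | g w <= v].
Proof.
move=> mg; rewrite (_ : [set w | _] = setT `&` g @^-1` `]-oo, v]%classic).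
  by apply: mg => //; exact: measurable_itv.
by rewrite setTI; apply/seteqP; split=> w /=; rewrite in_itv.
Qed.

Lemma markov_ge0 d (S : measurableType d) (P : probability S R) (g : S -> R) (eps v : R) :
  0 < eps -> measurable_fun setT g -> (forall w, 0 <= g w) ->
  (\int[P]_w (g w)%:E <= v%:E)%E ->
  ((1 - v / eps)%:E <= P [set w | (g w <= eps)%R])%E.
Proof.
move=> eps0 mg g0 gv.
have mA : measurable [set w | g w <= eps] := measurable_sublevel eps mg.
set A := [set w | _] in mA *.
have mC : measurable (~` A) by exact: measurableC.
have h : (eps%:E * P (~` A) <= v%:E)%E.
  apply: le_trans gv.
  have -> : (eps%:E * P (~` A) = \int[P]_w (eps * \1_(~` A) w)%:E)%E.
    under eq_integral do rewrite EFinM.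
    rewrite ge0_integralZl_EFin ?(ltW eps0)//; last exact/measurable_EFinP.
    by rewrite integral_indic// setIT.
  apply: ge0_le_integral_outer => w; rewrite lee_fin; first by rewrite mulr_ge0 ?(ltW eps0).
  have [wA|wA] := leP (g w) eps.
    by rewrite indicE memNset ?mulr0//= => /(_ wA).
  by rewrite indicE mem_set ?mulr1 ?ltW//= => /le_lt_trans/(_ wA); rewrite ltxx.
have := probability_setC P mC; rewrite setCK => ->.
have fin : P (~` A) \is a fin_num by exact: fin_num_measure.
rewrite -(fineK fin) -EFinB lee_fin lerD2l lerN2 ler_pdivlMr// mulrC.
by move: h; rewrite -(fineK fin) -EFinM lee_fin.
Qed.

Context (p : R) (p2 : 2 <= p).

Let p1 : 1 < p. Proof. by rewrite (lt_le_trans _ p2)// ltr1n. Qed.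
Let p0 : 0 < p. Proof. by rewrite (lt_trans _ p1). Qed.

Lemma pnorm_zero d (T : measurableType d) (mu : {measure set T -> \bar R}) :
  pnorm mu p 0 = 0.
Proof.
rewrite /pnorm (_ : EFin \o 0 = cst 0%E); last by apply/funext.
by rewrite Lnorm0// eqe gt_eqF.
Qed.

Lemma sample_mean_zero (T : Type) (m : nat) (x : 'I_m -> T) :
  sample_mean p x (0 : T -> R) = 0.
Proof.
rewrite /sample_mean big1 ?mulr0// => j _.
by rewrite normr0 powR0// gt_eqF.
Qed.

(** * Measurability of the sampling event *)

Section event.
Context (Omega : ptopologicalType) (mu : probability (borel Omega) R).
Context (N : nat) (L : set (Omega -> R)).
Hypothesis compactT : compact [set: Omega].
Hypothesis L_Lfun : forall f, L f -> f \in Lfun mu p%:E /\ continuous f.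
Hypothesis L_dim : subspace_of_dim N L.

Lemma measurable_sample_mean m d (S : measurableType d) (P : probability S R)
    (X : 'I_m -> {RV P >-> borel Omega}) f : L f ->
  measurable_fun setT (fun w => sample_mean p (X ^~ w) f).
Proof.
move=> Lf; apply: measurable_funM => //; apply: measurable_sum => j.
apply: measurable_norm_powR.
have mf : measurable_fun setT (f : borel Omega -> R) := measurable_in_L L_Lfun Lf.
exact: (measurableT_comp mf (measurable_funPT (X j))).
Qed.

(** The intersection over [L] is uncountable, but both sides of the inequalities depend continuously
    on the coefficients, so rational coefficients suffice. *)
Lemma measurable_event (eps : R) m d (S : measurableType d) (P : probability S R)
    (X : 'I_m -> {RV P >-> borel Omega}) : 0 < eps < 1 -> (0 < m)%N ->
  measurable [set w | forall f, L f ->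
    (1 - eps) * pnorm mu p f `^ p <= sample_mean p (X ^~ w) f <=
    (1 + eps) * pnorm mu p f `^ p].
Proof.
move=> /andP[eps0 eps1] m0; have [e [_ Ls]] := L_dim.
have mR : 0 < m%:R :> R by rewrite ltr0n.
pose F (a : 'I_N -> R) := \sum_(i < N) a i *: e i.
have LF a : L (F a) := span_in Ls a.
have mF a : measurable_fun setT (F a : borel Omega -> R) := measurable_in_L L_Lfun (LF a).
have Le i : L (e i) := span_basis Ls i.
pose J a := pnorm mu p (F a) `^ p.
pose mean w a := sample_mean p (X ^~ w) (F a).
pose Q n (i : 'I_N) : R :=
  if unpickle n is Some f then ratr ((f : {ffun 'I_N -> rat}) i) else 0.
have -> : [set w | forall f, L f ->
    (1 - eps) * pnorm mu p f `^ p <= sample_mean p (X ^~ w) f <=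
    (1 + eps) * pnorm mu p f `^ p] =
  \bigcap_n [set w | (1 - eps) * J (Q n) <= mean w (Q n) <= (1 + eps) * J (Q n)].
  apply/seteqP; split=> [w h n _|w h f]; first exact/h/LF.
  rewrite {1}Ls => -[a _ <-]; rewrite -/(F a) -/(J a) -/(mean w a).
  have [b bP] := choice (fun i => continuous_norm_bounded compactT (L_Lfun (Le i)).2).
  pose b' := \sum_i b i.
  have bi0 i : 0 <= b i := le_trans (normr_ge0 _) (bP i point).
  have b'0 : 0 <= b' by exact: sumr_ge0.
  pose a' := \sum_i `|a i|.
  have a'0 : 0 <= a' by exact: sumr_ge0.
  have ai i : `|a i| <= a' by rewrite /a' (bigD1 i)//= lerDl sumr_ge0.
  have Fb v c x : (forall i, `|v i| <= c) -> 0 <= c -> `|F v x| <= c * b'.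
    move=> vc c0; rewrite /F sum_scale_apply; apply: (le_trans (ler_norm_sum _ _ _)).
    rewrite mulr_sumr; apply: ler_sum => i _; rewrite normrM.
    by apply: ler_pM.
  pose B := (a' + 1) * b'.
  have B0 : 0 <= B by rewrite mulr_ge0// addr_ge0.
  pose k := p * B `^ (p - 1) * b'.
  have k0 : 0 <= k := mulr_ge0 (mulr_ge0 (ltW p0) (powR_ge0 _ _)) b'0.
  have approx eta : 0 < eta -> exists n, `|J (Q n) - J a| <= k * eta /\
      `|mean w (Q n) - mean w a| <= k * eta.
    (* The cap at 1 keeps the rational vector in the box of radius [a' + 1], where one Lipschitz
       constant for the [p]-th power is valid. *)
    move=> eta0; pose z := Num.min eta 1.
    have z0 : 0 < z by rewrite lt_min eta0 ltr01.
    have zeta : z <= eta by rewrite ge_min lexx.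
    have z1 : z <= 1 by rewrite ge_min lexx orbT.
    have [r rP] := choice (fun i => rat_in_itvoo (ltr_pwDr z0 (lexx (a i)))).
    exists (pickle [ffun i => r i]).
    have QE i : Q (pickle [ffun i => r i]) i = ratr (r i).
      by rewrite /Q pickleK ffunE.
    set v := Q _ in QE *.
    have va i : `|v i - a i| <= z.
      by rewrite QE; have := rP i; rewrite in_itv/= => /andP[? ?];
        rewrite ler_norml; apply/andP; split; lra.
    have vB i : `|v i| <= a' + 1.
      have := ler_normD (v i - a i) (a i); rewrite subrK.
      by have := va i; have := ai i; lra.
    have vx x : `| `|F v x| `^ p - `|F a x| `^ p| <= k * eta.
      have a'1 : 0 <= a' + 1 by rewrite addr_ge0.
      have h1 : `|F v x| <= B by exact: Fb.
      have h2 : `|F a x| <= B.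
        by apply: Fb => // i; apply: (le_trans (ai i)); rewrite lerDl.
      apply: (le_trans (powR_lipschitz p1 _ _ h1 h2)) => //.
      rewrite /k -mulrA -(mulrA p) -(mulrA p) ler_wpM2l ?(ltW p0)// -mulrA.
      rewrite ler_wpM2l ?powR_ge0//; apply: (le_trans (ler_dist_dist _ _)).
      have -> : F v x - F a x = F (fun i => v i - a i) x.
        by rewrite /F !sum_scale_apply -sumrB; apply: eq_bigr => i _; rewrite mulrBl.
      rewrite mulrC; apply: (@le_trans _ _ (z * b')); last by rewrite ler_wpM2r.
      by apply: Fb => //; exact: ltW.
    split.
      apply: (@integral_diff_le _ _ _ mu (fun x => `|F v x| `^ p)
        (fun x => `|F a x| `^ p)) => //.
      - by apply: measurable_norm_powR; exact: mF.
      - by apply: measurable_norm_powR; exact: mF.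
      - exact (integral_pnorm p2 L_Lfun (LF v)).
      - exact (integral_pnorm p2 L_Lfun (LF a)).
    rewrite /mean /sample_mean -mulrBr -sumrB normrM ger0_norm ?invr_ge0 ?(ltW mR)//.
    rewrite ler_pdivrMl//; apply: (le_trans (ler_norm_sum _ _ _)).
    apply: (@le_trans _ _ (\sum_(j < m) k * eta)); last first.
      by rewrite sumr_const card_ord -[leLHS]mulr_natl.
    by apply: ler_sum => j _; exact: vx.
  (* Thirds suffice: one for the empirical mean and at most two for the norm, as [1 + eps <= 2]. *)
  have small z : 0 < z -> exists n, `|J (Q n) - J a| <= z / 3 /\
      `|mean w (Q n) - mean w a| <= z / 3.
    move=> z0; have k1 : 0 < k + 1 by rewrite ltr_wpDl.
    have [n [h1 h2]] := approx (z / 3 / (k + 1)) (divr_gt0 (divr_gt0 z0 (ltr0Sn _ _)) k1).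
    have kz : k * (z / 3 / (k + 1)) <= z / 3.
      rewrite mulrA ler_pdivrMr// mulrC ler_wpM2l ?lerDl//.
      by rewrite divr_ge0 ?ltW.
    by exists n; split; [exact: le_trans h1 kz|exact: le_trans h2 kz].
  apply/andP; split; apply/ler_addgt0Pr => z z0.
    have [n []] := small z z0; have /andP[+ _] := h n I.
    rewrite !ler_norml => ? /andP[? ?] /andP[? ?].
    suff : (1 - eps) * (J a - J (Q n)) <= z / 3 by lra.
    apply: (@le_trans _ _ ((1 - eps) * (z / 3))).
      by rewrite ler_wpM2l; lra.
    by rewrite ler_piMl ?divr_ge0 ?ltW//; lra.
  have [n []] := small z z0; have /andP[_ +] := h n I.
  rewrite !ler_norml => ? /andP[? ?] /andP[? ?].
  suff : (1 + eps) * (J (Q n) - J a) <= 2 * (z / 3) by lra.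
  apply: (@le_trans _ _ ((1 + eps) * (z / 3))).
    by rewrite ler_wpM2l; lra.
  by rewrite ler_wpM2r ?divr_ge0 ?ltW//; lra.
apply: bigcapT_measurable => n.
rewrite (_ : [set w | _] = setT `&` (fun w => mean w (Q n)) @^-1`
  `[(1 - eps) * J (Q n), (1 + eps) * J (Q n)]%classic).
  by apply: measurable_sample_mean => //; exact: measurable_itv.
by rewrite setTI; apply/seteqP; split=> w /=; rewrite in_itv.
Qed.

End event.
End consequences.

Lemma subspace_dim0 (R : realType) (T : Type) (L : set (T -> R)) f :
  subspace_of_dim 0 L -> L f -> f = 0.
Proof. by move=> [e [_ ->]] [a _ <-]; rewrite big_ord0. Qed.

Lemma subspace_zero (R : realType) (T : Type) N (L : set (T -> R)) :
  subspace_of_dim N L -> L 0.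
Proof.
move=> [e [_ ->]]; exists (fun=> 0) => //.
by rewrite big1// => i _; rewrite scale0r.
Qed.

Theorem corollary4p8 (R : realType) (p : R) (hp : 2 <= p) :
  (exists C : R,
    forall (Omega : ptopologicalType) (mu : probability (borel Omega) R)
      (N : nat) (M : R) (L : set (Omega -> R)),
      compact [set: Omega] ->
      (forall f, L f -> f \in Lfun mu p%:E /\ continuous f) ->
      subspace_of_dim N L ->
      (forall f, L f -> supnorm f <= M * N%:R `^ p^-1 * pnorm mu p f) ->
      forall m : nat, (2 <= m)%N ->
      forall (d : measure_display) (S : measurableType d)
        (P : probability S R) (X : 'I_m -> {RV P >-> borel Omega}),
        iid_sample mu X ->
        let t := ln m%:R `^ p / m%:R * M `^ p * N%:R in
        ('E_P[fun w => sup [set `|sample_mean p (X ^~ w) f - pnorm mu p f `^ p|%R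
                           | f in unit_pball mu p L]]
         <= (C * (t + t `^ p^-1))%:E)%E)
  /\
  (forall eps delta : R, 0 < eps < 1 -> 0 < delta < 1 ->
   exists c : R,
    forall (Omega : ptopologicalType) (mu : probability (borel Omega) R)
      (N : nat) (M : R) (L : set (Omega -> R)),
      compact [set: Omega] ->
      (forall f, L f -> f \in Lfun mu p%:E /\ continuous f) ->
      subspace_of_dim N L ->
      (forall f, L f -> supnorm f <= M * N%:R `^ p^-1 * pnorm mu p f) ->
      forall m : nat,
        c * M `^ p * N%:R * ln (4 * M `^ p * N%:R) `^ p <= m%:R ->
      forall (d : measure_display) (S : measurableType d)
        (P : probability S R) (X : 'I_m -> {RV P >-> borel Omega}),
        iid_sample mu X ->
        ((1 - delta)%:E <
         P [set w | forall f, L f ->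
              ((1 - eps) * pnorm mu p f `^ p
                <= sample_mean p (X ^~ w) f
                <= (1 + eps) * pnorm mu p f `^ p)%R])%E).
Proof.
have p1 : 1 < p by rewrite (lt_le_trans _ hp)// ltr1n.
have p0 : 0 < p by rewrite (lt_trans _ p1).
have [K K0 dom] := sampling_domination hp.
split.
  exists K => Omega mu N M L cT LL Ldim Ln m m2 d S P X iidX.
  set t := ln m%:R `^ p / m%:R * M `^ p * N%:R.
  have L0 := subspace_zero Ldim.
  have ball0 : unit_pball mu p L 0 by split=> //; rewrite pnorm_zero.
  have [g [mg g0 gK gdev]] : exists g : S -> R, [/\ measurable_fun setT g,
      forall w, 0 <= g w, (\int[P]_w (g w)%:E <= (K * (t + t `^ p^-1))%:E)%E &
      forall w f, L f -> `|sample_mean p (X ^~ w) f - pnorm mu p f `^ p| <=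
      g w * pnorm mu p f `^ p].
    (* For [N = 0] the space is zero and there is no lower bound on [M^p N], so this case is treated
       apart. *)
    have [N0|N0] := posnP N; last exact: dom N0 cT LL Ldim Ln m t m2 erefl d S P X iidX.
    exists (fun=> 0); split=> //.
      rewrite integral0 lee_fin mulr_ge0// addr_ge0 ?powR_ge0//.
      by rewrite /t N0 mulr0.
    move=> w f Lf; have -> : f = 0 by apply: subspace_dim0 Lf; rewrite -N0.
    rewrite sample_mean_zero// pnorm_zero// powR0 ?gt_eqF//.
    by rewrite subrr normr0 mulr0.
  have bound w f : unit_pball mu p L f ->
      `|sample_mean p (X ^~ w) f - pnorm mu p f `^ p| <= g w.
    move=> [Lf f1]; apply: (le_trans (gdev w f Lf)).
    rewrite -[leRHS]mulr1 ler_wpM2l//.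
    apply: (@le_trans _ _ (1 `^ p)); last by rewrite powR1.
    by apply: ge0_ler_powR; rewrite ?nnegrE ?(ltW p0) ?pnorm_ge0.
  rewrite unlock; apply: le_trans gK; apply: ge0_le_integral_outer => w; rewrite lee_fin.
    by apply: le_trans (sup_image_ge (bound w) ball0); exact: normr_ge0.
  by apply: sup_image_le (bound w); exists 0.
move=> eps delta eps01 delta01.
have /andP[eps0 eps1] := eps01; have /andP[delta0 delta1] := delta01.
(* Markov's inequality then bounds the failure probability by [v / eps = delta / 2], which leaves
   room for the strict inequality. *)
pose v := eps * delta / 2.
have v0 : 0 < v by rewrite divr_gt0 ?mulr_gt0.
pose om := v / (2 * (K + 1)).
have om0 : 0 < om by rewrite divr_gt0// mulr_gt0// ltr_wpDl.
(* [t <= tau] makes both [t] and [t^(1/p)] at most [om], hence [K (t + t^(1/p)) <= 2 K om <= v]. *)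
pose tau := Num.min om (om `^ p).
have tau0 : 0 < tau by rewrite lt_min om0 powR_gt0.
have [c cP] := sample_size hp tau0.
exists c => Omega mu N M L cT LL Ldim Ln m mc d S P X iidX.
set E := [set w | _].
have delta1P : ((1 - delta)%:E < 1%E)%E by rewrite lte_fin; lra.
have [N0|N0] := posnP N.
  have -> : E = setT.
    apply/seteqP; split=> // w _ f Lf /=.
    have -> : f = 0 by apply: subspace_dim0 Lf; rewrite -N0.
    by rewrite sample_mean_zero// pnorm_zero// powR0 ?gt_eqF// !mulr0 lexx.
  by rewrite probability_setT.
have [e [ef Ls]] := Ldim.
have [M0 D1] := nikolskii_const hp N0 cT LL ef Ls Ln.
have [m2 tle] : (2 <= m)%N /\ ln m%:R `^ p / m%:R * (M `^ p * N%:R) <= tau.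
  by apply: cP => //; rewrite !mulrA.
have m0 : (0 < m)%N by rewrite (ltn_trans _ m2).
set t := _ * _ in tle.
have tE : t = ln m%:R `^ p / m%:R * M `^ p * N%:R by rewrite /t mulrA.
have [g [mg g0 gK gdev]] := dom _ _ _ _ _ N0 cT LL Ldim Ln m t m2 tE d S P X iidX.
have t0 : 0 <= t.
  by rewrite /t mulr_ge0 ?divr_ge0 ?powR_ge0// (le_trans _ D1).
have t1 : t <= om by apply: (le_trans tle); rewrite ge_min lexx.
have t2 : t `^ p^-1 <= om.
  apply: (@le_trans _ _ ((om `^ p) `^ p^-1)).
    apply: ge0_ler_powR; rewrite ?nnegrE ?invr_ge0 ?(ltW p0) ?powR_ge0//.
    by apply: (le_trans tle); rewrite ge_min lexx orbT.
  by rewrite -powRrM mulfV ?gt_eqF// powRr1// ltW.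
have Kv : K * (t + t `^ p^-1) <= v.
  apply: (@le_trans _ _ (K * (2 * om))); first by rewrite ler_wpM2l//; lra.
  have -> : K * (2 * om) = v * (K / (K + 1)).
    by rewrite /om; field; rewrite gt_eqF// ltr_wpDl.
  by rewrite ler_piMr ?(ltW v0)// ler_pdivrMr ?ltr_wpDl// mul1r lerDl.
have gv : (\int[P]_w (g w)%:E <= v%:E)%E by apply: (le_trans gK); rewrite lee_fin.
have := markov_ge0 eps0 mg g0 gv.
have mE : measurable E := measurable_event hp cT LL Ldim X eps01 m0.
have mA : measurable [set w | g w <= eps] := measurable_sublevel eps mg.
have sub : [set w | g w <= eps] `<=` E.
  move=> w /= geps f Lf.
  have := le_trans (gdev w f Lf) (ler_wpM2r (powR_ge0 _ _) geps).
  by rewrite ler_norml => /andP[? ?]; apply/andP; split; lra.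
move=> h; apply: lt_le_trans (le_trans h (le_measure P _ _ sub)); rewrite ?inE//.
rewrite lte_fin ltrD2l ltrN2 /v.
have -> : eps * delta / 2 / eps = delta / 2 by field; rewrite gt_eqF.
lra.
Qed.
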